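(* Let $n\geq 2$ be an integer. For $x,y>0$ define $$F_n(x,y)=\sum_{k=1}^{\lfloor \sqrt{x}\,y\rfloor}\left(\sum_{l\mid k}\frac{\mu(l)}{l^{n-1}}\right)\left(x-\left(\frac{k}{y}\right)^2\right)^{(n-1)/2}.$$ For each $x>0$, the function $y\mapsto F_n(x,y)$ is continuous, vanishes for $y\leq 1/\sqrt{x}$ and is strictly increasing for $y>1/\sqrt{x}$; let $Y_n(x)>0$ be the (continuous in $x$) value with $F_n(x,Y_n(x))=\frac{((n-1)/2)!}{\pi^{(n-1)/2}}$, and set $C_n(x)=\sup_{0<\xi\leq x}\xi\,(Y_n(\xi))^{2/n}$. If $\tilde\gamma_{n-1}$ is a positive real number with $\tilde\gamma_{n-1}\leq\gamma_{n-1}$, then $\gamma_n\geq C_n(\tilde\gamma_{n-1})$.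
   Context: $\gamma_m$ denotes the Hermite constant in dimension $m$: $\gamma_m=\sup_\Lambda \min\Lambda/(\det\Lambda)^{1/m}$ over $m$-dimensional Euclidean lattices $\Lambda$, where $\min\Lambda$ is the squared length of a shortest nonzero vector and $\det\Lambda$ the Gram determinant. $\mu$ is the Möbius function; $\sum_{l\mid k}$ runs over positive divisors of $k$; $x!=\Gamma(x+1)$. *)

(* Defs.v *)
From HB Require Import structures.
From mathcomp Require Export all_boot all_order all_algebra.
From mathcomp Require Export all_classical all_reals all_analysis.

Set Implicit Arguments.
Unset Strict Implicit.
Unset Printing Implicit Defensive.

Import Order.TTheory GRing.Theory Num.Theory.
Import numFieldNormedType.Exports.

Local Open Scope classical_set_scope.
Local Open Scope ring_scope.

(* Only meaningful for l > 0. *)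
Definition mobius (l : nat) : int :=
  if all (fun p => logn p l == 1%N) (primes l) then (-1) ^+ size (primes l)
  else 0.

Section RealFactorial.
Variable R : realType.

Definition Gamma (s : R) : R :=
  \int[lebesgue_measure]_(t in `]0, +oo[) (t `^ (s - 1) * expR (- t)).

Definition rfact (s : R) : R := Gamma (s + 1).

End RealFactorial.

Section Lattices.
Variables (R : realType) (m : nat).

(* An m-dimensional Euclidean lattice is given, up to isometry, by a basis of
   R^m: the rows of an invertible matrix B. *)
Definition lattice (B : 'M[R]_m) : set 'rV[R]_m :=
  [set v | exists z : 'rV[int]_m, v = map_mx intr z *m B].

Definition sqnorm (v : 'rV[R]_m) : R := \sum_(i < m) v 0 i ^+ 2.

Definition shortest_vectors (B : 'M[R]_m) : set 'rV[R]_m :=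
  [set v | [/\ lattice B v, v != 0 &
    forall w, lattice B w -> w != 0 -> sqnorm v <= sqnorm w]].

(* All shortest vectors have the same squared length; the default value 0 is
   never used when 0 < m and B is invertible. *)
Definition lattice_min (B : 'M[R]_m) : R :=
  xget 0 (sqnorm @` shortest_vectors B).

Definition lattice_det (B : 'M[R]_m) : R := \det (B *m B^T).

(* The supremum is taken in the extended reals, so that finiteness does not
   have to be established beforehand. *)
Definition hermite_constant : \bar R :=
  ereal_sup [set (lattice_min B / lattice_det B `^ m%:R^-1)%:E
            | B in [set B : 'M[R]_m | B \in unitmx]].

End Lattices.

Section LowerBound.
Variables (R : realType) (n : nat).

Definition F (x y : R) : R :=
  \sum_(1 <= k < (Num.truncn (Num.sqrt x * y)).+1)
    (\sum_(l <- divisors k) (mobius l)%:~R / l%:R ^+ n.-1)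
    * (x - (k%:R / y) ^+ 2) `^ ((n%:R - 1) / 2).

Definition level : R :=
  rfact ((n%:R - 1) / 2) / pi `^ ((n%:R - 1) / 2).

(* Junk value 0 unless F x takes the value [level] at a positive point. *)
Definition Y (x : R) : R := xget 0 [set y | 0 < y /\ F x y = level].

Definition C (x : R) : \bar R :=
  ereal_sup [set (xi * Y xi `^ (2 / n%:R))%:E | xi in `]0, x]].

End LowerBound.

Arguments hermite_constant R m : clear implicits.
Arguments level R n : clear implicits.

(* Main.v *)
Require Import Defs.
From mathcomp Require Import ring lra measurable_realfun.

(** Let [m = n - 1] and let [L] be an [m]-dimensional lattice of determinant 1
    and minimum at least [x]. For [h = 1 / y] and [v] in the torus [R^m / L],
    consider the [n]-dimensional lattice of all [(l + k v, k h)] with [l] in [L]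
    and [k] in [Z]; its determinant is [h ^ 2]. If it has a nonzero vector of
    squared length below [x], it has a primitive one with [k > 0]. The number of
    those, averaged over [v], is the sum over [k] of [J k / k ^ m] times the
    volume of the [m]-ball of squared radius [x - (k h) ^ 2], where
    [J k = k ^ m * sum_(l | k) mu(l) / l ^ m] (Jordan's totient) counts the
    residue classes of [Z^m] modulo [k] that are prime to [k]. This average is
    [V_m * F n x y], so if [F n x y < 1 / V_m] some [v] gives a lattice of
    minimum at least [x], whence the Hermite constant is at least
    [x * y ^ (2 / n)].
    The average is taken over the [N]-division points of the torus for one large
    [N], which only needs an upper bound for the number of points of a
    translated lattice in a large ball, uniform in the translation. That bound
    follows by slicing: a sum over a line of a unimodal function is at most its
    integral plus a constant multiple of its maximum. *)

Set Implicit Arguments.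
Unset Strict Implicit.
Unset Printing Implicit Defensive.

Import Order.TTheory GRing.Theory Num.Theory.
Import numFieldNormedType.Exports.

Local Open Scope classical_set_scope.
Local Open Scope ring_scope.

(** * Unit ball volumes and factorials of half-integers *)

(** The volume enters only through this two-step recursion and never as a measure: both the Gamma
    integral and the integral of a slice of the ball satisfy matching recursions. *)
Fixpoint ball_volume (R : realType) (m : nat) : R :=
  match m with
  | 0 => 1
  | 1 => 2
  | k.+2 => 2 * pi / k.+2%:R * ball_volume R k
  end.

Section Volume.
Variable R : realType.

Lemma powR_half (a : R) m : 0 <= a -> a `^ (m%:R / 2) = Num.sqrt a ^+ m.
Proof.
by move=> a0; rewrite powRrM powRAC powR12_sqrt// powR_mulrn ?sqrtr_ge0.
Qed.

Notation mu := (@lebesgue_measure R).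

Lemma nat_ind2 (P : nat -> Prop) :
  P 0%N -> P 1%N -> (forall m, P m -> P m.+2) -> forall m, P m.
Proof.
move=> P0 P1 PS m; suff: P m /\ P m.+1 by case.
by elim: m => [|m [Pm Pm1]]; split=> //; apply: PS.
Qed.

Lemma ball_volume_gt0 m : 0 < ball_volume R m.
Proof.
elim/nat_ind2: m => [|| m IH] //=.
by rewrite mulr_gt0// divr_gt0// mulr_gt0// pi_gt0.
Qed.

(** Boundary term at infinity for the integrations by parts below: for [t >= 1] the power is at most
    [t ^ m.+1], while [expR t] is at least [t ^ m.+2] divided by a factorial. *)
Lemma cvg_sqrtX_expRN m :
  Num.sqrt t ^+ m.+1 * expR (- t) @[t --> +oo] --> (0 : R).
Proof.
have cvg_inv (c : R) : c / t @[t --> +oo] --> (0 : R).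
  rewrite -[X in _ --> X](mulr0 c); apply: cvgMl_tmp.
  apply/(gtr0_cvgV0 (f := id)); last exact: cvg_id.
  exact: nbhs_pinfty_gt.
apply: (@squeeze_cvgr _ _ _ _ (fun=> 0) (fun t : R => (m.+2)`!%:R / t)).
- near=> t.
  have t1 : 1 <= t by near: t; exact: nbhs_pinfty_ge.
  have t0 : 0 < t by apply: lt_le_trans t1.
  rewrite mulr_ge0 ?expR_ge0 ?exprn_ge0//= expRN ler_pdivrMr ?expR_gt0//.
  have /le_trans -> // : Num.sqrt t ^+ m.+1 <= t ^+ m.+1.
    apply: lerXn2r; rewrite ?nnegrE ?sqrtr_ge0 ?(ltW t0)//.
    rewrite -[leLHS]mulr1 -[leRHS](sqr_sqrtr (ltW t0)) expr2.
    by rewrite ler_wpM2l// -sqrtr1 ler_wsqrtr.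
  have := expR_ge1Dxn m.+1 (ltW t0) => h.
  have : t ^+ m.+2 / m.+2`!%:R <= expR t by apply: le_trans h; rewrite lerDr.
  rewrite ler_pdivrMr ?ltr0n ?fact_gt0// => {}h.
  by rewrite mulrAC ler_pdivlMr// -exprSr mulrC.
- exact: cvg_cst.
- exact: cvg_inv.
Unshelve. all: by end_near. Qed.

Lemma is_derive_sqrtX m (t : R) : 0 < t ->
  is_derive t 1 (fun t => Num.sqrt t ^+ m.+2) ((m.+2)%:R / 2 * Num.sqrt t ^+ m).
Proof.
move=> t0; have s0 : Num.sqrt t != 0 by rewrite gt_eqF// sqrtr_gt0.
have -> : (fun t : R => Num.sqrt t ^+ m.+2) = Num.sqrt ^+ m.+2.
  by apply/funext => x; rewrite fctE.
apply: (is_derive_eq (is_deriveX m.+2 (is_derive1_sqrt t0))).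
rewrite /GRing.scale/= exprS.
by field.
Qed.

(** The hypotheses of the fundamental theorem of calculus on the half-line; the last clause is the
    resulting value of the Gamma integral at [m / 2 + 1]. *)
Let gamma_derivable_antiderivative m (A : R -> R) (l : R) :=
  [/\ A t @[t --> +oo] --> l,
      forall t : R, 0 < t -> is_derive t 1 A (Num.sqrt t ^+ m * expR (- t)),
      A t @[t --> 0^'+] --> A 0 &
      l - A 0 = Num.sqrt pi ^+ m / ball_volume R m].

Lemma is_derive_integral_gauss (t : R) : 0 < t ->
  is_derive t 1 (fun x => \int[mu]_(s in `[0, x]) gauss_fun s) (gauss_fun t).
Proof.
move=> t0.
have [] := @continuous_FTC1 R gauss_fun (BLeft 0) t (t + 1) _ _ _ _.
- by rewrite ltrDl.
- apply: (integrableS _ _ _ (@integrableT_gauss R)) => //.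
- by rewrite lte_fin.
- exact: continuous_gauss_fun.
- by move=> d <-; rewrite derive1E; exact: DeriveDef.
Qed.

(** Square root of the limit [pi / 4] of the squared integral, which is legitimate since the
    integral is nonnegative. *)
Lemma cvg_integral_gauss :
  (\int[mu]_(s in `[0, x]) gauss_fun s) @[x --> +oo] --> Num.sqrt (pi : R) / 2.
Proof.
have : Num.sqrt (@gauss_integral_proof.integral0_gauss R x ^+ 2) @[x --> +oo]
    --> Num.sqrt (pi / 4).
  apply: continuous_cvg => //; first exact: sqrt_continuous.
  exact: gauss_integral_proof.cvg_integral0_gauss_sqr.
rewrite sqrtrM ?pi_ge0// sqrtrV// (_ : 4 = 2 ^+ 2); last first.
  by rewrite expr2 -natrM.
rewrite sqrtr_sqr ger0_norm//.
rewrite (_ : (fun _ => Num.sqrt _) = @gauss_integral_proof.integral0_gauss R)//.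
apply/funext => r; rewrite sqrtr_sqr ger0_norm//.
exact: gauss_integral_proof.integral0_gauss_ge0.
Qed.

Lemma cvg_sqrt_pinfty : Num.sqrt t @[t --> +oo] --> (+oo : set_system R).
Proof.
apply/cvgryPge => M; near=> t.
have : (Num.max M 0) ^+ 2 <= t.
  by near: t; apply: nbhs_pinfty_ge; exact: num_real.
move=> /ler_wsqrtr; rewrite sqrtr_sqr ger0_norm ?le_max ?lexx ?orbT//.
by apply: le_trans; rewrite le_max lexx.
Unshelve. all: by end_near. Qed.

(** One integration by parts passes from [m] to [m.+2] and yields the factor [m.+2 / 2], which
    matches the recursion of [ball_volume]. For [m = 1] the same integration by parts leaves
    [expR (- t) / (2 * Num.sqrt t)], the Gaussian after the substitution [t = u ^ 2]. *)
Lemma gamma_antiderivative m : exists A l, gamma_derivable_antiderivative m A l.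
Proof.
have cE (t : R) : {for t, continuous (fun t : R => expR (- t))}.
  apply: (@continuous_comp _ _ _ (fun x : R => - x) expR).
    exact: (@opp_continuous R).
  exact: continuous_expR.
have dE (t : R) : is_derive t 1 (fun t : R => expR (- t)) (- expR (- t)).
  have ? := is_derive1_comp (is_derive_expR (- t)) (is_deriveNid t 1).
  by apply: is_derive_eq; rewrite mulrN1.
elim/nat_ind2: m => [||m [A [l [Al dA cA lA]]]].
- exists (fun t => - expR (- t)), 0; split.
  + by rewrite -oppr0; apply: cvgN; exact: cvgr_expR.
  + move=> t t0; apply: (is_derive_eq (is_deriveN (dE t))).
    by rewrite opprK mul1r.
  + by apply: cvg_at_right_filter; apply: cvgN; exact: cE.
  + by rewrite oppr0 expR0 sub0r opprK expr0 divr1.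
- pose H (x : R) := \int[mu]_(s in `[0, x]) gauss_fun s.
  exists (fun t => H (Num.sqrt t) - Num.sqrt t * expR (- t)), (Num.sqrt pi / 2).
  split.
  + rewrite -[X in _ --> X]subr0; apply: cvgB; last exact: (@cvg_sqrtX_expRN 0).
    exact: (cvg_comp _ _ cvg_sqrt_pinfty cvg_integral_gauss).
  + move=> t t0; have s0 : 0 < Num.sqrt t by rewrite sqrtr_gt0.
    have ds := is_derive1_sqrt t0.
    have dH := is_derive_integral_gauss s0.
    apply: (is_derive_eq
      (is_deriveB (is_derive1_comp dH ds) (is_deriveM ds (dE t)))).
    rewrite /gauss_fun sqr_sqrtr ?ltW// /GRing.scale/= expr1.
    by field; rewrite gt_eqF.
  + have H0 : H 0 = 0.
      by rewrite /H set_itv1 /Rintegral integral_set1.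
    apply: cvgB; last first.
      apply: cvg_at_right_filter; apply: cvgM; last exact: cE.
      exact: sqrt_continuous.
    rewrite sqrtr0 H0.
    have H1 : H x @[x --> 0^'+] --> (0 : R).
      have : mu.-integrable `[0, 1] (EFin \o @gauss_fun R).
        by apply: (integrableS _ _ _ (@integrableT_gauss R)).
      move/(parameterized_integral_cvg_left ltr01) => /cvg_at_right_filter.
      exact.
    apply/cvgrPdist_le => e e0.
    have /cvgrPdist_le/(_ _ e0)[d /= d0 Hd] := H1.
    near=> t.
    have t0 : 0 < t by near: t; exact: nbhs_right_gt.
    apply: Hd; rewrite ?sqrtr_gt0//= sub0r normrN ger0_norm//.
    rewrite -[ltRHS]ger0_norm ?ltW// -sqrtr_sqr ltr_sqrt ?exprn_gt0//.
    by near: t; apply: nbhs_right_lt; rewrite exprn_gt0.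
  + have H0 : H 0 = 0.
      by rewrite /H set_itv1 /Rintegral integral_set1.
    by rewrite sqrtr0 mul0r subr0 H0 subr0 expr1.
- pose c : R := m.+2%:R / 2.
  exists (fun t => - (Num.sqrt t ^+ m.+2 * expR (- t)) + c * A t), (c * l).
  split.
  + rewrite -[X in _ --> X]add0r; apply: cvgD; last exact: cvgMl_tmp.
    by rewrite -oppr0; apply: cvgN; exact: cvg_sqrtX_expRN.
  + move=> t t0; apply: (is_derive_eq (is_deriveD
      (is_deriveN (is_deriveM (is_derive_sqrtX m t0) (dE t)))
      (is_deriveZ c (dA _ t0)))).
    rewrite /GRing.scale/= /c; ring.
  + apply: cvgD; last exact: cvgMl_tmp.
    apply: cvgN; apply: cvg_at_right_filter; apply: cvgM; last exact: cE.
    apply: (@continuous_comp _ _ _ Num.sqrt (fun x : R => x ^+ m.+2)).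
      exact: sqrt_continuous.
    exact: exprn_continuous.
  + rewrite sqrtr0 expr0n/= mul0r oppr0 add0r -mulrBr lA /c exprS exprS.
    rewrite mulrA -expr2 sqr_sqrtr ?pi_ge0//.
    have := ball_volume_gt0 m; have := pi_gt0 R => p0 b0.
    move: (m.+2%:R : R) (ltr0Sn R m.+1) => k k0.
    move: (pi : R) p0 => p p0.
    by field; rewrite !gt_eqF.
Unshelve. all: by end_near. Qed.

Lemma rfact_half m : rfact (m%:R / 2) = Num.sqrt pi ^+ m / ball_volume R m.
Proof.
rewrite /rfact /Gamma.
pose f (t : R) := Num.sqrt t ^+ m * expR (- t).
have cf : continuous f.
  move=> t; apply: cvgM.
    apply: (@continuous_comp _ _ _ Num.sqrt (fun x : R => x ^+ m)).
      exact: sqrt_continuous.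
    exact: exprn_continuous.
  apply: (@continuous_comp _ _ _ (fun x : R => - x) expR).
    exact: (@opp_continuous R).
  exact: continuous_expR.
transitivity (\int[mu]_(t in `]0, +oo[) f t).
  apply: eq_Rintegral => t; rewrite inE/= in_itv/= andbT => t0.
  by rewrite addrK powR_half// ltW.
rewrite /Rintegral integral_itv_obnd_cbnd; last first.
  apply/measurable_EFinP; apply: measurable_funTS.
  exact: continuous_measurable_fun.
rewrite -/(Rintegral mu _ f).
have [A [l [Al dA cA <-]]] := gamma_antiderivative m.
apply: (@Rintegral_ge0_continuous_FTC2y _ f A) => //.
- by move=> x _; rewrite mulr_ge0 ?expR_ge0// exprn_ge0.
- exact: continuous_subspaceT.
- by move=> x /dA[].
- move=> x; rewrite in_itv/= andbT => /dA dx.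
  by rewrite derive1E derive_val.
Qed.

Lemma levelE m : level R m.+1 = (ball_volume R m)^-1.
Proof.
rewrite /level -natr1 addrK rfact_half powR_half ?pi_ge0//.
rewrite mulrAC divff ?mul1r//.
by rewrite expf_neq0// gt_eqF// sqrtr_gt0 pi_gt0.
Qed.
End Volume.

(** * Riemann sums of powers of [Num.sqrt (1 - u ^ 2)] *)

Section CapSums.
Variable R : realType.
Implicit Types (u x : R) (j m : nat).

Lemma continuous_sqrt_poly j :
  continuous (fun u : R => Num.sqrt (1 - u ^+ 2) ^+ j).
Proof.
move=> u.
apply: (@continuous_comp _ _ _ (fun u : R => Num.sqrt (1 - u ^+ 2))
  (fun x => x ^+ j)); last exact: exprn_continuous.
apply: (@continuous_comp _ _ _ (fun u : R => 1 - u ^+ 2) Num.sqrt); last first.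
  exact: sqrt_continuous.
apply: cvgB; first exact: cvg_cst.
exact: exprn_continuous.
Qed.

Lemma is_derive_1Bsqr u : is_derive u 1 (fun u : R => 1 - u ^+ 2) (- (2 * u)).
Proof.
have h := is_deriveX 2 (is_derive_id u (1 : R)).
have h2 := is_deriveB (is_derive_cst (1 : R) u 1) h.
have -> : (fun u : R => 1 - u ^+ 2) = cst 1 - (id ^+ 2).
  by apply/funext => x; rewrite !fctE.
apply: (is_derive_eq h2).
by rewrite /GRing.scale/=; ring.
Qed.

Lemma is_derive_sqrt_poly j u : -1 < u < 1 ->
  is_derive u 1 (fun u => Num.sqrt (1 - u ^+ 2) ^+ j.+2)
    (- (j.+2%:R * u * Num.sqrt (1 - u ^+ 2) ^+ j)).
Proof.
move=> u1; have v0 : 0 < 1 - u ^+ 2 by nra.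
have h := @is_derive1_comp _ _ (fun u : R => 1 - u ^+ 2) u _ _
  (is_derive_sqrtX j v0) (is_derive_1Bsqr u).
rewrite (_ : (fun u : R => _) =
  (fun t : R => Num.sqrt t ^+ j.+2) \o (fun u : R => 1 - u ^+ 2))//.
by apply: (is_derive_eq h); field.
Qed.

Lemma continuous_asin_cc : {within `[(-1 : R), 1], continuous asin}.
Proof.
have := @segment_can_le_continuous R (- (pi / 2)) (pi / 2) sin asin.
rewrite sinN sin_pihalf; apply.
- by rewrite -subr_ge0 opprK addr_ge0// divr_ge0// pi_ge0.
- by apply: continuous_subspaceT; exact: continuous_sin.
- exact: sinK.
Qed.

(** The unit ball of dimension [j.+1] is sliced by hyperplanes into balls of radius
    [Num.sqrt (1 - u ^ 2)]. With [I j] the integral over [[-1, 1]], integration by parts gives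
    [(j + 3) * I (j + 2) = (j + 2) * I j], since the boundary term vanishes at both ends. *)
Lemma cap_antiderivative j : exists A : R -> R,
  [/\ {within `[-1, 1], continuous A},
      forall u, -1 < u < 1 -> is_derive u 1 A (Num.sqrt (1 - u ^+ 2) ^+ j) &
      A 1 - A (-1) = ball_volume R j.+1 / ball_volume R j].
Proof.
elim/nat_ind2: j => [||j [A [cA dA A1]]].
- exists id; split; last by rewrite /=; field.
    by apply: continuous_subspaceT => x; exact: cvg_id.
  by move=> u _; apply: (is_derive_eq (is_derive_id u 1)); rewrite expr0.
- exists (fun u => 2^-1 * (u * Num.sqrt (1 - u ^+ 2) + asin u)); split.
  + move=> x; apply: cvgMl_tmp; apply: cvgD; last exact: continuous_asin_cc.
    move: x; apply: continuous_subspaceT.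
    move=> u; apply: cvgM; first exact: cvg_id.
    exact: (@continuous_sqrt_poly 1).
  + move=> u u1; have v0 : 0 < 1 - u ^+ 2 by nra.
    have ds := @is_derive1_comp _ _ (fun u : R => 1 - u ^+ 2) u _ _
      (is_derive1_sqrt v0) (is_derive_1Bsqr u).
    apply: (is_derive_eq (is_deriveZ 2^-1 (is_deriveD
      (is_deriveM (is_derive_id u 1) ds) (is_derive1_asin u1)))).
    have s0 : 0 < Num.sqrt (1 - u ^+ 2) by rewrite sqrtr_gt0.
    have := sqr_sqrtr (ltW v0).
    rewrite /GRing.scale/= expr1; move: (Num.sqrt _) s0 => s s0 s2.
    have -> : u * ((2 * s)^-1 * - (2 * u)) = - (1 - s ^+ 2) / s.
      by rewrite s2; field; rewrite gt_eqF.
    by field; rewrite gt_eqF.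
  + have -> : asin (1 : R) = pi / 2.
      rewrite -[X in asin X]sin_pihalf; apply: sinK.
      rewrite in_itv/= lexx ?andbT -subr_ge0 opprK.
      by rewrite addr_ge0// divr_ge0// pi_ge0.
    have -> : asin (-1 : R) = - (pi / 2).
      rewrite -[X in asin (- X)]sin_pihalf -sinN; apply: sinK.
      by rewrite in_itv/= lexx -subr_ge0 opprK addr_ge0// divr_ge0// pi_ge0.
    rewrite sqrrN expr1n subrr sqrtr0/=; move: (pi : R) => p.
    by field.
- pose k : R := j.+2%:R; have k0 : 0 < k by rewrite ltr0n.
  have kS : j.+3%:R = k + 1 by rewrite /k natr1.
  exists (fun u => (k + 1)^-1 *
    (u * Num.sqrt (1 - u ^+ 2) ^+ j.+2 + k * A u)); split.
  + move=> x; apply: cvgMl_tmp; apply: cvgD; last first.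
      by apply: cvgMl_tmp; exact: cA.
    move: x; apply: continuous_subspaceT.
    move=> u; apply: cvgM; first exact: cvg_id.
    exact: continuous_sqrt_poly.
  + move=> u u1; have v0 : 0 < 1 - u ^+ 2 by nra.
    apply: (is_derive_eq (is_deriveZ (k + 1)^-1 (is_deriveD
      (is_deriveM (is_derive_id u 1) (is_derive_sqrt_poly j u1))
      (is_deriveZ k (dA _ u1))))).
    have := sqr_sqrtr (ltW v0).
    rewrite /GRing.scale/= -/k; move: (Num.sqrt _) => s s2.
    rewrite -addn2 exprD s2; move: (s ^+ j) => t; field.
    by rewrite gt_eqF// addr_gt0.
  + have -> : ball_volume R j.+3 / ball_volume R j.+2
        = 2 * pi / j.+3%:R * ball_volume R j.+1
          / (2 * pi / k * ball_volume R j) by [].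
    have := ball_volume_gt0 R j; have := ball_volume_gt0 R j.+1.
    have := pi_gt0 R.
    move: (pi : R) (ball_volume R j.+1) (ball_volume R j) A1.
    move=> p a b A1 p0 a0 b0.
    rewrite sqrrN expr1n subrr sqrtr0 expr0n/= !mulr0 !add0r -!mulrBr A1 kS.
    by field; rewrite !gt_eqF// addr_gt0.
Qed.

(** Once the integers are sorted, consecutive ones satisfy [k <= k' - 1], so the unit intervals
    [[k - 1, k]] do not overlap and the increments telescope up to nonnegative gaps. *)
Lemma sum_increments_le (g : int -> R) (L U : R) (ks : seq int) :
  {homo g : x y / x <= y} -> (forall k, L <= g k <= U) -> uniq ks ->
  \sum_(k <- ks) (g k - g (k - 1)) <= U - L.
Proof.
move=> gm gLU uks.
have srt : sorted <%O (sort <=%O ks) by rewrite sort_lt_sorted.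
rewrite (perm_big (sort <=%O ks)); last by rewrite perm_sym perm_sort.
move: (sort _ ks) srt => {uks} {}ks.
case: ks => [|k ks] pk.
  by rewrite big_nil subr_ge0; have /andP[] := gLU 0; exact: le_trans.
suff /le_trans : \sum_(i <- k :: ks) (g i - g (i - 1)) <= U - g (k - 1).
  by apply; rewrite lerD2l lerN2; have /andP[] := gLU (k - 1).
elim: ks k pk => [k _|k' ks IH k /= /andP[kk' pk]].
  by rewrite big_seq1 lerD2r; have /andP[] := gLU k.
rewrite big_cons; apply: le_trans (lerD (lexx _) (IH _ pk)) _.
have : g k <= g (k' - 1) by apply: gm; rewrite -ltzD1 subrK.
by move: (g k) (g (k - 1)) (g (k' - 1)) => a b e; lra.
Qed.

(* A unimodal function is compared with its integral on each side of its
   maximum; the at most two intervals meeting the maximum cost [2 * d]. *)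
Lemma cap_sum_le j (d c : R) (ks : seq int) : 0 < d -> uniq ks ->
  {in ks, forall k, `|d * k%:~R + c| < 1} ->
  d * \sum_(k <- ks) Num.sqrt (1 - (d * k%:~R + c) ^+ 2) ^+ j
    <= ball_volume R j.+1 / ball_volume R j + 2 * d.
Proof.
move=> d0 uks ks1; have [A [cA dA <-]] := cap_antiderivative j.
pose f u := Num.sqrt (1 - u ^+ 2) ^+ j.
have f_mono u v : u ^+ 2 <= v ^+ 2 -> f v <= f u.
  move=> uv; rewrite /f; have : Num.sqrt (1 - v ^+ 2) <= Num.sqrt (1 - u ^+ 2).
    by apply: ler_wsqrtr; rewrite lerB.
  by apply: lerXn2r; rewrite nnegrE sqrtr_ge0.
have f_ge0 u : 0 <= f u by rewrite exprn_ge0 ?sqrtr_ge0.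
have f_le1 u : f u <= 1.
  have -> : 1 = f 0 by rewrite /f expr0n/= subr0 sqrtr1 expr1n.
  by apply: f_mono; rewrite expr0n/= sqr_ge0.
have mvt a b : -1 <= a -> a <= b -> b <= 1 ->
    exists2 e, a <= e <= b & A b - A a = f e * (b - a).
  move=> a1 ab b1.
  have [||e] := @MVT_segment R A f a b ab.
  - move=> x; rewrite in_itv/= => /andP[ax xb]; apply: dA.
    by rewrite (le_lt_trans a1)//= (lt_le_trans xb).
  - apply: continuous_subspaceW cA => x/=; rewrite !in_itv/= => /andP[ax xb].
    by rewrite (le_trans a1)//= (le_trans xb).
  - by rewrite in_itv/= => ?; exists e.
have A_mono a b : -1 <= a -> a <= b -> b <= 1 -> A a <= A b.
  move=> a1 ab b1; have [e _ AB] := mvt _ _ a1 ab b1.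
  by rewrite -subr_ge0 AB mulr_ge0// subr_ge0.
(* Clamping to [[0, 1]] or [[-1, 0]] keeps the arguments of [A] where it is known to be monotone,
   and confines each use to one side of the maximum of [f]. *)
pose cl (a b x : R) := Num.min b (Num.max a x).
have cl_in a b x : a <= b -> a <= cl a b x <= b.
  by move=> ab; rewrite /cl le_min ge_min ab le_max !lexx.
have cl_id a b x : a <= x -> x <= b -> cl a b x = x.
  by move=> ax xb; rewrite /cl (max_idPr ax) (min_idPr xb).
have cl_mono a b : {homo cl a b : x y / x <= y}.
  move=> x y xy; rewrite /cl le_min; apply/andP; split.
    by rewrite ge_min lexx.
  rewrite ge_min; apply/orP; right.
  by rewrite ge_max !le_max lexx xy orbT.
pose X (k : int) := d * k%:~R + c.
have X_mono : {homo X : x y / x <= y}.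
  by move=> x y xy; rewrite lerD2r ler_pM2l// ler_int.
have XB k : X (k - 1) = X k - d by rewrite /X intrB; ring.
have XD k : X (k + 1) = X k + d by rewrite /X intrD; ring.
(* From [k - 1] to [k] each of the four terms is nondecreasing, and one of them gains at least
   [d * f (X k)]. If [d <= X k], the first gains the integral over [[X k - d, X k]]; if
   [X k <= - d], the second gains that over [[X k, X k + d]]. Otherwise an indicator jumps, the last
   one if [0 <= X k] and the third if [X k < 0], and [f <= 1]. *)
pose g k := A (cl 0 1 (X k)) + A (cl (-1) 0 (X (k + 1)))
   + (- d < X k)%R%:R * d + (0 <= X k)%R%:R * d.
have clg a b x : a <= b -> (a <= cl a b x) * (cl a b x <= b).
  by move=> ab; have /andP[-> ->] := cl_in a b x ab.
have A01 x y : x <= y -> A (cl 0 1 x) <= A (cl 0 1 y).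
  move=> xy; apply: A_mono; rewrite ?clg ?cl_mono//.
  by rewrite (@le_trans _ _ 0)// ?clg// lerN10.
have AN0 x y : x <= y -> A (cl (-1) 0 x) <= A (cl (-1) 0 y).
  move=> xy; apply: A_mono; rewrite ?clg ?lerN10 ?cl_mono//.
  by rewrite (@le_trans _ _ 0)// clg// lerN10.
have B1 x y : x <= y -> ((- d < x)%R%:R : R) <= (- d < y)%R%:R.
  by move=> xy; rewrite ler_nat; case: (ltP (- d) x) => // /lt_le_trans ->.
have B2 x y : x <= y -> ((0 <= x)%R%:R : R) <= (0 <= y)%R%:R.
  by move=> xy; rewrite ler_nat; case: (leP 0 x) => // /le_trans ->.
have := @sum_increments_le g (A 0 + A (-1)) (A 1 + A 0 + 2 * d) ks.
have -> : A 1 + A 0 + 2 * d - (A 0 + A (-1)) = A 1 - A (-1) + 2 * d by ring.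
move=> H; apply: le_trans (H _ _ uks).
- rewrite mulr_sumr; rewrite !big_seq; apply: ler_sum => k kks.
  have := ks1 _ kks; rewrite -/(X k) -/(f (X k)) ltr_norml => /andP[X1 X2].
  rewrite /g subrK XB XD.
  move: (X k) X1 X2 => x X1 X2.
  have xd : x - d <= x by rewrite gerBl ltW.
  have dx : x <= x + d by rewrite lerDl ltW.
  have := A01 _ _ xd; have := AN0 _ _ dx; have := B1 _ _ xd; have := B2 _ _ xd.
  have [dlx|xltd] := leP d x.
    have [|||e /andP[e1 e2]] := mvt (x - d) x; [lra|lra|lra|].
    rewrite !(cl_id 0 1); [|lra|lra|lra|lra].
    have : f x <= f e by apply: f_mono; nra.
    move=> fe AB b2 b1 a2 a1; have fed : f x * d <= f e * d by rewrite ler_pM2r.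
    nra.
  have [xln|nltx] := leP x (- d).
    have [|||e /andP[e1 e2]] := mvt x (x + d); [lra|lra|lra|].
    rewrite !(cl_id (-1) 0); [|lra|lra|lra|lra].
    have : f x <= f e by apply: f_mono; nra.
    move=> fe AB b2 b1 a2 a1; have fed : f x * d <= f e * d by rewrite ler_pM2r.
    nra.
  have fd : d * f x <= d by rewrite ler_piMr// ltW.
  have [x0|x0] := leP 0 x.
    rewrite (_ : 0 <= x - d = false); last by apply/negbTE; rewrite -ltNge; lra.
    move=> _ b1 a2 a1.
    have b1d : (- d < x - d)%R%:R * d <= 1 * d by rewrite ler_pM2r.
    by rewrite /=; lra.
  rewrite (_ : - d < x - d = false); last by apply/negbTE; rewrite -leNgt; lra.
  move=> b2 _ a2 a1.
  have b2d : (0 <= x - d)%R%:R * d <= 0 * d by rewrite ler_pM2r.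
  by rewrite /=; lra.
- move=> k l kl; rewrite /g.
  have Xkl : X k <= X l by apply: X_mono.
  have Xkl' : X (k + 1) <= X (l + 1) by apply: X_mono; rewrite lerD2r.
  by rewrite !lerD ?A01 ?AN0 ?ler_pM2r ?B1 ?B2.
- move=> k; rewrite /g.
  have h1 : A 0 <= A (cl 0 1 (X k)) <= A 1.
    by rewrite !A_mono ?clg ?lerN10//; rewrite (@le_trans _ _ 0) ?clg ?lerN10.
  have h2 : A (-1) <= A (cl (-1) 0 (X (k + 1))) <= A 0.
    by rewrite !A_mono ?clg ?lerN10//; rewrite (@le_trans _ _ 0) ?clg ?lerN10.
  have h3 (b : bool) : 0 <= b%:R * d <= d.
    by case: b; rewrite ?mul1r ?mul0r lexx ltW.
  have := h3 (- d < X k); have := h3 (0 <= X k).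
  move: (_ * d) (_ * d) (A (cl _ _ _)) (A (cl _ _ _)) h1 h2 => ? ? ? ? *.
  lra.
Qed.

End CapSums.

(** * Counting the lattice points of a translated ellipsoid *)

Lemma size_fibers (T U : eqType) (f : T -> U) (s : seq T) :
  size s = (\sum_(k <- undup (map f s)) size [seq z <- s | f z == k])%N.
Proof.
under eq_bigr => k _ do rewrite size_filter -sum1_count.
rewrite (exchange_big_dep predT)//= -sum1_size; rewrite !big_seq.
apply: eq_bigr => z zs.
under eq_bigl => k do rewrite eq_sym.
by rewrite sum1_count count_uniq_mem ?undup_uniq// mem_undup map_f.
Qed.

Section Counting.
Variable R : realType.

Definition qform m (G : 'M[R]_m) (v : 'rV[R]_m) : R := (v *m G *m v^T) 0 0.

Definition posdef m (G : 'M[R]_m) : Prop :=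
  G^T = G /\ forall v, v != 0 -> 0 < qform G v.

Lemma qform_ge0 m (G : 'M[R]_m) v : posdef G -> 0 <= qform G v.
Proof.
move=> [_ Gp]; have [->|/Gp/ltW//] := eqVneq v 0.
by rewrite /qform !mul0mx mxE.
Qed.

Section Schur.
Variables (m : nat) (G : 'M[R]_(1 + m)).
Hypothesis G_posdef : posdef G.

Let b := ursubmx G.
Let H := drsubmx G.
Let w := b *m invmx H.
(** The vector [row_mx 1 (- w)] is orthogonal, for the form [G], to every [row_mx 0 y]. Hence [s] is
    the Schur complement of [H], the squared height of the first basis vector over the span of the
    others. *)
Let s := qform G (row_mx 1 (- w)).

Lemma posdef_drsubmx : posdef H.
Proof.
have [Gs Gp] := G_posdef; split; first by rewrite /H trmx_drsub Gs.
move=> v v0; have := Gp (row_mx 0 v).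
have -> : qform G (row_mx 0 v) = qform H v.
  rewrite /qform -[G in LHS]submxK mul_row_block tr_row_mx mul_row_col trmx0.
  by rewrite mulmx0 add0r !mul0mx !add0r.
apply; apply: contraNneq v0 => /(congr1 rsubmx); rewrite row_mxKr => ->.
by rewrite linear0.
Qed.

Hypothesis H_unit : H \in unitmx.

Lemma schur_gt0 : 0 < s.
Proof.
have [_ Gp] := G_posdef; apply: Gp.
apply/negP => /eqP/(congr1 lsubmx); rewrite row_mxKl linear0.
move=> /matrixP/(_ 0 0).
by rewrite !mxE eqxx => /eqP; rewrite oner_eq0.
Qed.

Lemma schur_factor :
  G = block_mx 1%:M w 0 1%:M *m block_mx s%:M 0 0 H *m block_mx 1%:M 0 w^T 1%:M.
Proof.
have [Gs _] := G_posdef.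
have Hs : H^T = H by rewrite /H trmx_drsub Gs.
have wH : w *m H = b by rewrite /w mulmxKV.
have Hw : H *m w^T = b^T by have := congr1 trmx wH; rewrite trmx_mul Hs.
have dl : dlsubmx G = b^T by rewrite /b trmx_ursub Gs.
have sE : (s%:M : 'M[R]_1) = ulsubmx G - b *m w^T.
  rewrite /s /qform -[G in LHS]submxK mul_row_block tr_row_mx mul_row_col trmx1.
  rewrite dl -/H -/b !mulNmx wH !mul1mx subrr mul0mx addr0 mulmx1.
  by rewrite -Hw mulmxA wH [RHS]mx11_scalar.
rewrite -[G in LHS]submxK dl -/b -/H !mulmx_block.
rewrite !(mul0mx, mulmx0, mul1mx, mulmx1, add0r, addr0) wH Hw sE.
by rewrite subrK.
Qed.

Lemma det_schur : \det G = s * \det H.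
Proof.
rewrite [in LHS]schur_factor !det_mulmx.
rewrite !(@det_ublock _ 1 m) (@det_lblock _ 1 m).
by rewrite !det1 det_scalar1 !mul1r !mulr1.
Qed.

(** Completing the square: once the first coordinate is fixed, a point count for [G] becomes one for
    [H] with another translation and a smaller radius, which is the form the induction on the
    dimension consumes. *)
Lemma qform_schur (x : 'M[R]_1) (y : 'rV[R]_m) :
  qform G (row_mx x y) = s * x 0 0 ^+ 2 + qform H (y + x *m w).
Proof.
rewrite /qform schur_factor -!mulmxA mulmxA.
rewrite (_ : block_mx 1%:M 0 w^T 1%:M *m _ =
  (row_mx x y *m block_mx 1%:M w 0 1%:M)^T).
  rewrite mul_row_block mulmx0 !mulmx1 addr0 tr_row_mx.
  rewrite mul_block_col mul_row_col.
  rewrite !mul0mx !addr0 mxE; congr (_ + _).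
    by rewrite mul_scalar_mx -scalemxAr mxE mxE big_ord1 mxE; ring.
  by rewrite add0r [x *m w + y]addrC mulmxA.
by rewrite [RHS]trmx_mul (@tr_block_mx _ 1 m 1 m) !trmx1 trmx0.
Qed.

End Schur.

(* The count is a sum over the first coordinate of counts in dimension [m];
   [m * (T + 1) ^ m.-1] vanishes in dimension [0], where there is no error. *)
Lemma count_qform_lt m (G : 'M[R]_m) : posdef G ->
  0 < \det G /\
  exists2 K : R, 0 <= K & forall (T : R) (c : 'rV[R]_m) (s : seq 'rV[int]_m),
    0 <= T -> uniq s ->
    {in s, forall z, qform G (map_mx intr z + c) < T ^+ 2} ->
    (size s)%:R <= ball_volume R m / Num.sqrt (\det G) * T ^+ m
                   + K * (m%:R * (T + 1) ^+ m.-1).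
Proof.
elim: m G => [G Gp|m IH].
  rewrite det_mx00; split; first exact: ltr01.
  exists 0; first exact: lexx.
  move=> T c s T0 us _; rewrite sqrtr1 !mul0r divr1 mulr1 addr0 /=.
  rewrite (ler_nat _ _ 1); case: s us => [|z [|z' s]]//=.
  by rewrite inE [z]thinmx0 [z']thinmx0 eqxx.
rewrite -[m.+1]/(1 + m)%N => G Gp.
have Hp := posdef_drsubmx Gp.
have [dH [K K0 IHH]] := IH _ Hp.
have Hu : drsubmx G \in unitmx by rewrite unitmxE unitfE gt_eqF.
have s0 := schur_gt0 Gp.
have dG := det_schur Gp Hu.
have qG := qform_schur Gp Hu.
move: (drsubmx G) s0 dG qG Hp dH IHH Hu => H.
set s := qform G _; set w := _ *m _ => s0 dG qG Hp dH IHH Hu.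
split; first by rewrite dG mulr_gt0.
pose r := Num.sqrt s; have r0 : 0 < r by rewrite sqrtr_gt0.
pose A := ball_volume R m / Num.sqrt (\det H).
have A0 : 0 <= A by rewrite divr_ge0 ?sqrtr_ge0// ltW// ball_volume_gt0.
(* The term [2 * A] is the error of the Riemann sum over the slices; the other bounds the number of
   slices times the lower-order error within each slice. *)
exists (2 * A + (2 / r + 2) * K * m%:R).
  apply: addr_ge0; first exact: mulr_ge0.
  do 2 (apply: mulr_ge0 => //); apply: addr_ge0 => //.
  by apply: divr_ge0 => //; exact: ltW.
move=> T c l T0 ul lP.
(* Radius zero admits no point and is set aside because the slices are rescaled by [r / T]. *)
have [T00|Tn0] := eqVneq T 0.
  have -> : l = [::].
    case: l {ul} lP => // z l /(_ z); rewrite inE eqxx => /(_ isT).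
    by rewrite T00 expr0n/= ltNge qform_ge0.
  rewrite T00 expr0n/= mulr0 add0r add0r expr1n mulr1 mulr_ge0// addr_ge0//.
    by rewrite mulr_ge0.
  by rewrite !mulr_ge0// addr_ge0// divr_ge0// ltW.
have {}T0 : 0 < T by rewrite lt_neqAle eq_sym Tn0.
pose x0 : R := c 0 0.
pose fst (z : 'rV[int]_(1 + m)) := z 0 0.
pose ks := undup (map fst l).
pose q k : R := k%:~R + x0.
have zE z : z \in l ->
    s * q (fst z) ^+ 2 + qform H (map_mx intr (rsubmx z)
      + (rsubmx c + (q (fst z))%:M *m w)) < T ^+ 2.
  move=> /lP; rewrite -[map_mx _ z + c]hsubmxK qG.
  have -> : lsubmx (map_mx intr z + c) = (q (fst z))%:M.
    rewrite [LHS]mx11_scalar; congr (_%:M); rewrite !mxE /q /fst /x0.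
    by congr (_%:~R + _); congr (_ _ _); apply: val_inj.
  by rewrite mxE eqxx mulr1n linearD/= -map_rsubmx addrA.
have zT z : z \in l -> s * q (fst z) ^+ 2 < T ^+ 2.
  by move=> /zE; apply: le_lt_trans; rewrite lerDl qform_ge0.
(* Radius of the slice with first coordinate [k]. *)
pose t k := Num.sqrt (T ^+ 2 - s * q k ^+ 2).
have tT k : t k <= T.
  rewrite -[leRHS]ger0_norm ?(ltW T0)// -sqrtr_sqr; apply: ler_wsqrtr.
  by rewrite gerBl mulr_ge0 ?sqr_ge0// ltW.
have ksP k : k \in ks -> exists2 z, z \in l & k = fst z.
  by rewrite mem_undup => /mapP.
have fiber k : k \in ks ->
    (size [seq z <- l | fst z == k])%:R
      <= A * t k ^+ m + K * (m%:R * (T + 1) ^+ m.-1).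
  move=> /ksP[z0 z0l kE].
  have tk0 : 0 <= t k by exact: sqrtr_ge0.
  have := IHH (t k) (rsubmx c + (q k)%:M *m w)
    [seq rsubmx z | z <- l & fst z == k] tk0.
  rewrite size_map => IHk; apply: le_trans (IHk _ _) _.
  - rewrite map_inj_in_uniq ?filter_uniq// => z z'; rewrite !mem_filter.
    move=> /andP[/eqP zk _] /andP[/eqP z'k _] zz'.
    rewrite -[z]hsubmxK -[z']hsubmxK zz'; congr row_mx.
    rewrite [lsubmx z]mx11_scalar [lsubmx z']mx11_scalar !mxE.
    congr (_%:M); rewrite -z'k /fst in zk.
    by apply: etrans (etrans zk _); congr (_ _ _); apply: val_inj.
  - move=> y /mapP[z]; rewrite mem_filter => /andP[/eqP zk zl] ->.
    rewrite /t sqr_sqrtr; last by rewrite subr_ge0 ltW// kE zT.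
    by rewrite ltrBrDl -zk zE.
  rewrite lerD2l ler_wpM2l// ler_wpM2l//.
  by apply: lerXn2r; rewrite ?nnegrE ?addr_ge0// ?(ltW T0)// lerD2r.
have uks : uniq ks by exact: undup_uniq.
have dks : {in ks, forall k, `|r / T * k%:~R + r / T * x0| < 1}.
  move=> k /ksP[z zl ->]; rewrite -mulrDr -/(q (fst z)).
  rewrite -[ltRHS](@divff _ T) ?gt_eqF// mulrAC normrM.
  rewrite [X in _ * X]gtr0_norm ?invr_gt0//.
  rewrite ltr_pM2r ?invr_gt0// -(@ltr_pXn2r _ 2) ?nnegrE ?(ltW T0)//.
  by rewrite -normrX ger0_norm ?sqr_ge0// exprMn sqr_sqrtr ?(ltW s0)// zT.
have rT0 : 0 < r / T by rewrite divr_gt0.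
have tE k : t k = T * Num.sqrt (1 - (r / T * k%:~R + r / T * x0) ^+ 2).
  rewrite -[X in X * _](ger0_norm (ltW T0)) -sqrtr_sqr -sqrtrM ?sqr_ge0//.
  congr Num.sqrt; rewrite -mulrDr -/(q k) !exprMn sqr_sqrtr ?(ltW s0)//.
  by field; rewrite gt_eqF.
(* The number of slices is the sum of zeroth powers, so the case [j = 0] of [cap_sum_le] bounds
   it. *)
have card_ks : (size ks)%:R <= 2 / r * T + 2.
  have := cap_sum_le 0 rT0 uks dks.
  under eq_bigr do rewrite expr0.
  rewrite big_const_seq count_predT iter_addr_0 -ler_pdivlMl// invf_div.
  rewrite /= divr1 => /le_trans -> //.
  rewrite le_eqVlt; apply/orP; left; apply/eqP; field.
  by rewrite !gt_eqF.
have sum_t : \sum_(k <- ks) t k ^+ m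
    <= ball_volume R m.+1 / ball_volume R m / r * T ^+ m.+1 + 2 * T ^+ m.
  under eq_bigr do rewrite tE exprMn.
  rewrite -mulr_sumr.
  have := cap_sum_le m rT0 uks dks.
  rewrite -ler_pdivlMl// invf_div => h.
  apply: le_trans (ler_wpM2l _ h) _; first by rewrite exprn_ge0// ltW.
  rewrite exprSr le_eqVlt; apply/orP; left; apply/eqP.
  have := ball_volume_gt0 R m.
  move: (ball_volume R m.+1) (ball_volume R m) => v' v v0.
  by field; rewrite !gt_eqF.
rewrite (size_fibers fst) natr_sum.
apply: le_trans (_ :
  \sum_(k <- ks) (A * t k ^+ m + K * (m%:R * (T + 1) ^+ m.-1)) <= _).
  by rewrite !big_seq; apply: ler_sum => k; exact: fiber.
rewrite big_split -mulr_sumr big_const_seq count_predT iter_addr_0.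
set B := K * (m%:R * _); rewrite -[B *+ _]mulr_natl.
have B0 : 0 <= B by rewrite !mulr_ge0// exprn_ge0// addr_ge0// ltW.
apply: le_trans (lerD (ler_wpM2l A0 sum_t) (ler_wpM2r B0 card_ks)) _.
rewrite mulrDr -addrA; apply: lerD.
  rewrite dG sqrtrM ?(ltW s0)// -/r /A -[(1 + m)%N]/m.+1.
  have := ball_volume_gt0 R m.
  have : 0 < Num.sqrt (\det H) by rewrite sqrtr_gt0.
  move: (ball_volume R m.+1) (ball_volume R m) (Num.sqrt _) (T ^+ m.+1).
  move=> v' v h y h0 v0.
  by rewrite le_eqVlt; apply/orP; left; apply/eqP; field; rewrite !gt_eqF.
have T1 : 0 <= T + 1 by rewrite addr_ge0// ltW.
have e0 : 0 <= (T + 1) ^+ m by rewrite exprn_ge0.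
have hT : T ^+ m <= (T + 1) ^+ m.
  by apply: lerXn2r; rewrite ?nnegrE ?(ltW T0)// lerDl.
have hB : (2 / r * T + 2) * B <= (2 / r + 2) * K * m%:R * (T + 1) ^+ m.
  have -> : (2 / r + 2) * K * m%:R * (T + 1) ^+ m = (2 / r + 2) * (T + 1) * B.
    (* For [m = 0] the factor [m%:R] makes both sides vanish; for positive [m] the exponent [m.-1]
       absorbs one more factor [T + 1]. *)
    rewrite /B; case: (m) => [|m']; first by rewrite !(mul0r, mulr0).
    by rewrite /= exprS; ring.
  rewrite ler_wpM2r//; have : 0 < 2 / r by rewrite divr_gt0.
  by move: (2 / r) => x x_gt0; nra.
have hA : A * (2 * T ^+ m) <= 2 * A * (T + 1) ^+ m.
  by rewrite mulrCA mulrA ler_wpM2l// mulr_ge0.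
apply: le_trans (lerD hA hB) _.
rewrite -mulrDl -[leLHS]mulr1 -!mulrA ler_wpM2l//.
  apply: addr_ge0; first exact: mulr_ge0.
  apply: mulr_ge0; last by rewrite mulr_ge0.
  apply: addr_ge0 => //.
  by apply: divr_ge0 => //; exact: ltW.
by rewrite mulr1 -[leLHS]mul1r ler_wpM2r// ler1n.
Qed.

End Counting.

(** * Möbius inversion and Jordan's totient *)

Lemma mobius1 : mobius 1 = 1.
Proof. by []. Qed.

Lemma mobius_mul_prime p l : prime p -> (0 < l)%N -> ~~ (p %| l)%N ->
  mobius (p * l) = - mobius l.
Proof.
move=> pp l0 pl; have p0 := prime_gt0 pp.
have pr : perm_eq (primes (p * l)) (p :: primes l).
  apply: uniq_perm; rewrite ?primes_uniq//=.
    by rewrite primes_uniq andbT mem_primes (negbTE pl) !andbF.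
  by move=> q; rewrite primesM// primes_prime// inE in_cons.
rewrite /mobius (perm_all _ pr) (perm_size pr) /=.
have -> : logn p (p * l) = 1%N.
  by rewrite lognM// logn_prime// eqxx lognE (negbTE pl) !andbF.
rewrite eqxx /= (_ : all _ (primes l) =
  all (fun q => logn q l == 1%N) (primes l)).
  by case: ifP => _; rewrite ?oppr0// exprS mulN1r.
apply: eq_in_all => q; rewrite mem_primes => /and3P[pq _ ql].
rewrite lognM// logn_prime//.
by have [pqE|] := eqVneq q p; [rewrite -pqE ql in pl|rewrite add0n].
Qed.

Lemma mobius_dvd_sqr p l : prime p -> (0 < l)%N -> (p ^ 2 %| l)%N ->
  mobius l = 0.
Proof.
move=> pp l0 pl; rewrite /mobius ifF//; apply/negbTE/allPn; exists p.
  by rewrite mem_primes pp l0 (dvdn_trans _ pl)// dvdn_exp.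
by move: pl; rewrite pfactor_dvdn//; case: (logn p l) => [|[]].
Qed.

(** For a prime [p] dividing [g], the divisors [l] prime to [p] cancel against the divisors [p * l];
    the remaining ones are multiples of [p ^ 2], where [mobius] is zero. *)
Lemma sum_mobius_divisors g : (0 < g)%N ->
  \sum_(l <- divisors g) mobius l = (g == 1%N)%:R.
Proof.
move=> g0; have [->|g1] := eqVneq g 1%N; first by rewrite big_seq1.
have gt1 : (1 < g)%N by rewrite ltn_neqAle eq_sym g1.
pose p := pdiv g; have pp : prime p by exact: pdiv_prime.
have pg : (p %| g)%N by exact: pdiv_dvd.
have p0 := prime_gt0 pp.
rewrite (bigID (fun l => p %| l)%N) /= addrC.
rewrite [X in _ + X](bigID (fun l => p ^ 2 %| l)%N) /=.
rewrite [X in _ + (X + _)]big1_seq ?add0r; last first.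
  move=> l /andP[/andP[_ p2l]]; rewrite -dvdn_divisors// => lg.
  by apply: mobius_dvd_sqr p2l => //; exact: dvdn_gt0 lg.
rewrite -[X in _ + X]big_filter.
rewrite [X in _ + X](perm_big
  [seq (p * l)%N | l <- divisors g & ~~ (p %| l)%N]); last first.
  apply: uniq_perm.
  - by rewrite filter_uniq// divisors_uniq.
  - rewrite map_inj_uniq ?filter_uniq ?divisors_uniq// => a b /eqP.
    by rewrite eqn_pmul2l// => /eqP.
  move=> l; rewrite mem_filter -dvdn_divisors//; apply/idP/mapP.
    move=> /andP[/andP[/dvdnP[q ->] p2l] lg]; exists q; last by rewrite mulnC.
    rewrite mem_filter -dvdn_divisors// (dvdn_trans _ lg) ?dvdn_mulr// andbT.
    by apply: contra p2l; rewrite expnS expn1 => pq; rewrite dvdn_mul.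
  move=> [q]; rewrite mem_filter -dvdn_divisors// => /andP[pq qg] ->.
  rewrite dvdn_mulr// expnS expn1 dvdn_pmul2l// pq/=.
  by rewrite Gauss_dvd ?pg ?qg// prime_coprime.
rewrite big_map big_filter -big_split/= big1_seq// => l /andP[pl].
rewrite -dvdn_divisors// => lg.
by rewrite mobius_mul_prime ?subrr//; exact: dvdn_gt0 lg.
Qed.

Definition gcd_family (m k : nat) (z : {ffun 'I_m -> 'I_k}) : nat :=
  gcdn k (\big[gcdn/0%N]_i z i).

Definition primitive_residues (m k : nat) : {set {ffun 'I_m -> 'I_k}} :=
  [set z | gcd_family z == 1%N].

Lemma dvdn_gcd_family (m k l : nat) (z : {ffun 'I_m -> 'I_k}) :
  (l %| gcd_family z)%N = (l %| k)%N && [forall i, (l %| z i)%N].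
Proof.
rewrite dvdn_gcd; congr (_ && _).
apply/dvdn_biggcdP/forallP => h i; first exact: h.
by move=> _; exact: h.
Qed.

Lemma card_multiples (l q : nat) : (0 < l)%N ->
  #|[pred x : 'I_(l * q) | (l %| x)%N]| = q.
Proof.
move=> l0.
have lt (i : 'I_q) : (l * i < l * q)%N by rewrite ltn_pmul2l.
pose f i := Ordinal (lt i).
have fi : injective f.
  by move=> i j /(congr1 val)/eqP/=; rewrite eqn_pmul2l// => /eqP/val_inj.
rewrite -[RHS]card_ord -(fintype.card_image fi); apply: eq_card => x.
apply/idP/fintype.imageP => [/dvdnP[j xj]|[i _ ->]]; last first.
  by rewrite inE /= dvdn_mulr.
have jq : (j < q)%N by have := ltn_ord x; rewrite xj mulnC ltn_pmul2l.
by exists (Ordinal jq) => //; apply: val_inj; rewrite /= xj mulnC.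
Qed.

Section JordanTotient.
Variable R : realType.

Definition jordan_coef (m k : nat) : R :=
  \sum_(l <- divisors k) (mobius l)%:~R / l%:R ^+ m.

(** The indicator of gcd 1 is replaced by the sum of [mobius l] over the divisors [l] of the gcd.
    After exchanging the sums, the tuples with all entries divisible by [l] number [(k / l) ^ m]. *)
Lemma card_primitive_residues m k : (0 < k)%N ->
  (#|primitive_residues m k|)%:R = k%:R ^+ m * jordan_coef m k.
Proof.
move=> k0.
have -> : (#|primitive_residues m k|)%:R
    = \sum_(z : {ffun 'I_m -> 'I_k}) ((gcd_family z == 1%N)%:R : R).
  rewrite -sum1_card natr_sum [RHS](bigID [in primitive_residues m k])/=.
  rewrite [X in _ = _ + X]big1 ?addr0 => [|z]; last first.
    by rewrite inE => /negbTE ->.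
  by apply: eq_bigr => z; rewrite inE => ->.
transitivity (\sum_(z : {ffun 'I_m -> 'I_k})
    \sum_(l <- divisors k | (l %| gcd_family z)%N) ((mobius l)%:~R : R)).
  apply: eq_bigr => z _.
  have g0 : (0 < gcd_family z)%N by rewrite gcdn_gt0 k0.
  rewrite -[LHS](rmorph_nat (intr : int -> R)) -sum_mobius_divisors//.
  rewrite rmorph_sum/=.
  rewrite -[RHS]big_filter; apply: perm_big; apply: uniq_perm.
  - exact: divisors_uniq.
  - by rewrite filter_uniq// divisors_uniq.
  move=> l; rewrite mem_filter -!dvdn_divisors//.
  by rewrite andb_idr// => /dvdn_trans; apply; exact: dvdn_gcdl.
rewrite (exchange_big_dep predT)//= /jordan_coef mulr_sumr !big_seq.
apply: eq_bigr => l; rewrite -dvdn_divisors// => lk.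
have l0 : (0 < l)%N by exact: dvdn_gt0 lk.
rewrite sumr_const -[_ *+ #|_|]mulr_natr [RHS]mulrCA.
have -> : #|[pred z : {ffun 'I_m -> 'I_k} | (l %| gcd_family z)%N]|
    = ((k %/ l) ^ m)%N.
  case/dvdnP: lk => q kE; rewrite {}kE in k0 *.
  rewrite mulnK// mulnC -[in RHS](card_multiples q l0) -[in RHS](card_ord m).
  rewrite -card_ffun_on; apply: eq_card => z; rewrite !inE dvdn_gcd_family.
  by rewrite dvdn_mulr.
by rewrite natrX natr_div ?unitfE ?pnatr_eq0 -?lt0n// expr_div_n.
Qed.

(** The coefficient is a cardinal divided by [k ^ m], and the tuple of ones is primitive as soon as
    it has an entry. *)
Lemma jordan_coef_gt0 m k : (0 < m)%N -> (0 < k)%N -> 0 < jordan_coef m k.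
Proof.
move=> m0 k0; suff : (0 < #|primitive_residues m k|)%N.
  rewrite -(ltr0n R) card_primitive_residues// pmulr_rgt0//.
  by rewrite exprn_gt0// ltr0n.
case: k k0 => [//|k] _; apply/card_gt0P.
exists [ffun=> inord 1]; rewrite inE.
(* Modulo 1 the element [inord 1] is 0, but the gcd with the modulus is still 1. *)
case: k => [|k]; first by rewrite /gcd_family gcd1n.
rewrite -dvdn1; apply: dvdn_trans (dvdn_gcdr _ _) _.
have := @dvdn_biggcdP 'I_m xpredT (fun i => [ffun=> inord 1 : 'I_k.+2] i : nat).
move=> /(_ _)/elimT/(_ (dvdnn _) (Ordinal m0) isT).
by rewrite ffunE inordK.
Qed.

Lemma jordan_coef_prime m p : prime p -> jordan_coef m p = 1 - (p%:R ^+ m)^-1.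
Proof.
move=> pp; rewrite /jordan_coef (perm_big [:: 1%N; p]).
  rewrite big_cons big_seq1 mobius1 expr1n divr1.
  rewrite -[X in mobius X]muln1 mobius_mul_prime//.
    by rewrite mobius1 rmorphN mulN1r.
  by rewrite dvdn1; case: (p) pp => [|[]].
apply: uniq_perm; rewrite ?divisors_uniq//=.
  by rewrite inE andbT; case: (p) pp => [|[]].
move=> l; rewrite -dvdn_divisors ?prime_gt0// !inE.
apply/idP/idP; first by have /primeP[_ /(_ l)] := pp.
by move=> /orP[]/eqP ->.
Qed.

Lemma jordan_coef1 m : jordan_coef m 1 = 1.
Proof. by rewrite /jordan_coef big_seq1 mobius1 expr1n divr1. Qed.

End JordanTotient.

(** * Monotonicity and continuity of [F], and its level [Y] *)

Section LevelFunction.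
Variables (R : realType) (m : nat).
Hypothesis m_gt0 : (0 < m)%N.
Implicit Types (x y : R) (k M : nat).

Definition F_term x y k : R :=
  jordan_coef R m k * Num.sqrt (x - (k%:R / y) ^+ 2) ^+ m.

(** [Num.sqrt] is 0 at negative arguments and [m] is positive, so the terms past the cutoff vanish.
    A single bound [M] then serves for several arguments at once, which makes values of [F]
    comparable term by term. *)
Lemma F_truncE x y M : 0 < x -> 0 < y -> Num.sqrt x * y < M%:R ->
  F m.+1 x y = \sum_(1 <= k < M) F_term x y k.
Proof.
move=> x0 y0 xyM; have xy0 : 0 <= Num.sqrt x * y by rewrite mulr_ge0// ltW.
have tM : (Num.truncn (Num.sqrt x * y) < M)%N by rewrite truncn_lt_nat.
rewrite (@big_cat_nat _ _ _ (Num.truncn (Num.sqrt x * y)).+1 1 M)//=.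
rewrite [X in _ + X]big_nat [X in _ + X]big1 ?addr0 => [|k /andP[kt _]].
  rewrite /F !big_nat; apply: eq_bigr => k /andP[_ kt].
  rewrite /F_term /jordan_coef /=; congr (_ * _).
  rewrite -natr1 addrK powR_half// subr_ge0.
  move: kt; rewrite ltnS truncn_ge_nat// => kt.
  rewrite -[leRHS]sqr_sqrtr ?(ltW x0)//.
  apply: lerXn2r; rewrite ?nnegrE ?sqrtr_ge0 ?divr_ge0 ?(ltW y0)//.
  by rewrite ler_pdivrMr.
rewrite /F_term ler0_sqrtr ?expr0n ?gtn_eqF ?mulr0//.
rewrite subr_le0 -[leLHS]sqr_sqrtr ?(ltW x0)//.
move: kt; rewrite truncn_lt_nat// => /ltW kt.
by apply: lerXn2r; rewrite ?nnegrE ?sqrtr_ge0 ?divr_ge0 ?(ltW y0)// ler_pdivlMr.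
Qed.

Lemma F_term_le x1 x2 y1 y2 k : (0 < k)%N -> x1 <= x2 -> 0 < y1 -> y1 <= y2 ->
  F_term x1 y1 k <= F_term x2 y2 k.
Proof.
move=> k0 x12 y0 y12; have y20 : 0 < y2 by exact: lt_le_trans y12.
rewrite ler_pM2l ?jordan_coef_gt0//.
apply: lerXn2r; rewrite ?nnegrE ?sqrtr_ge0//; apply: ler_wsqrtr.
apply: lerB => //; apply: lerXn2r;
  rewrite ?nnegrE ?divr_ge0 ?(ltW y0) ?(ltW y20)//.
by rewrite ler_wpM2l// lef_pV2 ?posrE.
Qed.

Lemma F_le x1 x2 y1 y2 : 0 < x1 -> x1 <= x2 -> 0 < y1 -> y1 <= y2 ->
  F m.+1 x1 y1 <= F m.+1 x2 y2.
Proof.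
move=> x0 x12 y0 y12.
have x20 := lt_le_trans x0 x12; have y20 := lt_le_trans y0 y12.
pose M := (Num.truncn (Num.sqrt x2 * y2)).+1.
have xyM2 : Num.sqrt x2 * y2 < M%:R by exact: truncnS_gt.
have xyM1 : Num.sqrt x1 * y1 < M%:R.
  apply: le_lt_trans xyM2.
  by apply: ler_pM; rewrite ?sqrtr_ge0 ?(ltW y0)// ler_wsqrtr.
rewrite (F_truncE x0 y0 xyM1) (F_truncE x20 y20 xyM2) !big_nat.
by apply: ler_sum => k /andP[k0 _]; exact: F_term_le.
Qed.

Lemma F_eq0 x y : 0 < x -> 0 < y -> y <= 1 / Num.sqrt x -> F m.+1 x y = 0.
Proof.
move=> x0 y0; have sx0 : 0 < Num.sqrt x by rewrite sqrtr_gt0.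
rewrite ler_pdivlMr// mulrC => xy1.
rewrite (@F_truncE _ _ 2)//; last by rewrite (le_lt_trans xy1)// ltr1n.
rewrite big_nat1 /F_term ler0_sqrtr ?expr0n ?gtn_eqF ?mulr0//.
rewrite subr_le0 -[leLHS]sqr_sqrtr ?(ltW x0)//.
by apply: lerXn2r; rewrite ?nnegrE ?sqrtr_ge0 ?divr_ge0 ?(ltW y0)// ler_pdivlMr.
Qed.

(** The term [k = 1], of coefficient 1, increases strictly once [y1] exceeds the threshold; the
    other terms do not decrease. *)
Lemma F_lt x y1 y2 : 0 < x -> 1 / Num.sqrt x < y1 -> y1 < y2 ->
  F m.+1 x y1 < F m.+1 x y2.
Proof.
move=> x0 xy1 y12; have sx0 : 0 < Num.sqrt x by rewrite sqrtr_gt0.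
have y10 : 0 < y1 by apply: lt_trans xy1; rewrite divr_gt0.
have y20 : 0 < y2 by exact: lt_trans y12.
(* The extra successor guarantees [1 < M], so that the first term can be split off. *)
pose M := (Num.truncn (Num.sqrt x * y2)).+2.
have xyM2 : Num.sqrt x * y2 < M%:R.
  by apply: lt_trans (truncnS_gt _) _; rewrite ltr_nat.
have xyM1 : Num.sqrt x * y1 < M%:R.
  by apply: lt_trans xyM2; rewrite ltr_pM2l.
rewrite (F_truncE x0 y10 xyM1) (F_truncE x0 y20 xyM2) !(@big_ltn _ _ _ 1 M)//.
apply: ltr_leD; last first.
  rewrite !big_nat; apply: ler_sum => k /andP[k0 _].
  by apply: F_term_le; rewrite ?(ltnW k0) ?(ltW y12).
rewrite /F_term jordan_coef1 !mul1r.
have h1 : 0 < x - y1^-1 ^+ 2.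
  rewrite subr_gt0 -[ltRHS]sqr_sqrtr ?(ltW x0)//.
  rewrite ltr_pXn2r ?nnegrE ?invr_ge0 ?(ltW y10) ?sqrtr_ge0//.
  by rewrite invf_plt ?posrE// -div1r.
have h2 : x - y1^-1 ^+ 2 < x - y2^-1 ^+ 2.
  rewrite ltrD2l ltrN2 ltr_pXn2r ?nnegrE ?invr_ge0 ?(ltW y10) ?(ltW y20)//.
  by rewrite ltf_pV2 ?posrE.
by rewrite ltr_pXn2r ?nnegrE ?sqrtr_ge0// ltr_sqrt// (lt_trans h1).
Qed.

Lemma F_lt_of_gt0 x y1 y2 : 0 < x -> 0 < y1 -> y1 < y2 -> 0 < F m.+1 x y2 ->
  F m.+1 x y1 < F m.+1 x y2.
Proof.
move=> x0 y0 y12 Fy2; have [h|h] := leP y1 (1 / Num.sqrt x).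
  by rewrite F_eq0.
exact: F_lt.
Qed.

Lemma continuous_F_y x : 0 < x -> {in `]0, +oo[, continuous (F m.+1 x)}.
Proof.
move=> x0 y0; rewrite in_itv/= andbT => y00.
(* Near [y0] one has [y <= 2 * y0], so with this [M] the function is locally a fixed finite sum of
   continuous terms. *)
pose M := (Num.truncn (Num.sqrt x * (2 * y0))).+1.
have xyM : Num.sqrt x * (2 * y0) < M%:R by exact: truncnS_gt.
rewrite /continuous_at (@F_truncE _ _ M)//; last first.
  by apply: le_lt_trans xyM; rewrite ler_wpM2l ?sqrtr_ge0//; lra.
apply: cvg_trans (_ : \sum_(1 <= k < M) F_term x y k @[y --> y0] --> _).
  apply: near_eq_cvg; near=> y; rewrite (@F_truncE _ _ M)//.
    by near: y; exact: lt_nbhsr.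
  apply: le_lt_trans xyM; rewrite ler_wpM2l ?sqrtr_ge0//.
  by apply/ltW; near: y; apply: lt_nbhsl; lra.
apply: cvg_big => //; first by exact: add_continuous.
move=> k _; apply: cvgMl_tmp.
apply: (@continuous_comp _ _ _ (fun y => Num.sqrt (x - (k%:R / y) ^+ 2))
  (fun t : R => t ^+ m)); last exact: exprn_continuous.
apply: (@continuous_comp _ _ _ (fun y => x - (k%:R / y) ^+ 2) Num.sqrt);
  last exact: sqrt_continuous.
apply: cvgB; first exact: cvg_cst.
apply: (@continuous_comp _ _ _ (fun y => k%:R / y) (fun t : R => t ^+ 2));
  last exact: exprn_continuous.
by apply: cvgMl_tmp; apply: cvgV; [rewrite gt_eqF|exact: cvg_id].
Unshelve. all: by end_near. Qed.

Lemma continuous_F_x y : 0 < y -> {in `]0, +oo[, continuous (F m.+1 ^~ y)}.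
Proof.
move=> y0 x0; rewrite in_itv/= andbT => x00.
pose M := (Num.truncn (Num.sqrt (2 * x0) * y)).+1.
have xyM : Num.sqrt (2 * x0) * y < M%:R by exact: truncnS_gt.
rewrite /continuous_at (@F_truncE _ _ M)//; last first.
  by apply: le_lt_trans xyM; rewrite ler_pM2r// ler_wsqrtr//; lra.
apply: cvg_trans (_ : \sum_(1 <= k < M) F_term x y k @[x --> x0] --> _).
  apply: near_eq_cvg; near=> x; rewrite (@F_truncE _ _ M)//.
    by near: x; exact: lt_nbhsr.
  apply: le_lt_trans xyM; rewrite ler_pM2r// ler_wsqrtr//.
  by apply/ltW; near: x; apply: lt_nbhsl; lra.
apply: cvg_big => //; first by exact: add_continuous.
move=> k _; apply: cvgMl_tmp.
apply: (@continuous_comp _ _ _ (fun x => Num.sqrt (x - (k%:R / y) ^+ 2))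
  (fun t : R => t ^+ m)); last exact: exprn_continuous.
apply: (@continuous_comp _ _ _ (fun x => x - (k%:R / y) ^+ 2) Num.sqrt);
  last exact: sqrt_continuous.
by apply: cvgB; [exact: cvg_id|exact: cvg_cst].
Unshelve. all: by end_near. Qed.

(* Every prime has coefficient at least [1 / 2], whereas the coefficients
   themselves are not bounded away from [0] when [m = 1]. *)
Lemma sum_jordan_coef_unbounded j : exists M,
  j%:R / 2 <= \sum_(1 <= k < M) jordan_coef R m k.
Proof.
elim: j => [|j [M IH]]; first by exists 1%N; rewrite big_geq// mul0r.
have [p Mp pp] := prime_above M.
exists p.+1; rewrite big_nat_recr ?prime_gt0//= -natr1 mulrDl; apply: lerD.
  apply: le_trans IH _; case: (leqP 1 M) => M1; last first.
    have -> : \sum_(1 <= k < M) jordan_coef R m k = 0 by rewrite big_geq// ltnW.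
    rewrite big_nat; apply: sumr_ge0 => k /andP[k0 _].
    by rewrite ltW// jordan_coef_gt0.
  rewrite [leRHS](@big_cat_nat _ _ _ M)//=; last exact: ltnW.
  rewrite lerDl big_nat; apply: sumr_ge0 => k /andP[kM _].
  by rewrite ltW// jordan_coef_gt0// (leq_trans _ kM).
rewrite jordan_coef_prime// div1r lerBrDr -lerBrDl.
have p2 := prime_gt1 pp.
have : (p%:R ^+ m)^-1 <= 2^-1 :> R.
  rewrite lef_pV2 ?posrE ?exprn_gt0 ?ltr0n ?prime_gt0//.
  rewrite -natrX ler_nat (leq_trans p2)// -[X in (X <= _)%N]expn1 leq_pexp2l//.
  exact: prime_gt0.
by move: (_^-1) => t ht; lra.
Qed.

(** With [y = 2 * M' / Num.sqrt x], every [k < M'] has [(k / y) ^ 2 <= x / 4], so its term is at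
    least [q] times its coefficient, and the sums of coefficients are unbounded. *)
Lemma F_unbounded x L : 0 < x -> exists2 y, 0 < y & L <= F m.+1 x y.
Proof.
move=> x0; pose q := Num.sqrt (x / 4) ^+ m.
have q0 : 0 < q by rewrite exprn_gt0// sqrtr_gt0 divr_gt0.
have sx0 : 0 < Num.sqrt x by rewrite sqrtr_gt0.
pose j := (Num.truncn (2 * (L / q))).+1.
have [M hM] := sum_jordan_coef_unbounded j.
have jL : 2 * (L / q) < j%:R by exact: truncnS_gt.
pose M' := M.+1.
have M'0 : 0 < M'%:R :> R by rewrite ltr0n.
pose y := 2 * M'%:R / Num.sqrt x.
have y0 : 0 < y by rewrite divr_gt0// mulr_gt0.
exists y => //.
rewrite (@F_truncE _ _ (2 * M' + 1)%N)//; last first.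
  by rewrite /y mulrC divfK ?gt_eqF// natrD natrM ltrDl.
have L1 : L <= q * \sum_(1 <= k < M') jordan_coef R m k.
  rewrite -ler_pdivrMl// mulrC.
  have : \sum_(1 <= k < M) jordan_coef R m k
      <= \sum_(1 <= k < M') jordan_coef R m k.
    case: (posnP M) => [M0|M0]; first by rewrite /M' M0 !big_geq.
    by rewrite /M' big_nat_recr//= lerDl ltW// jordan_coef_gt0.
  move: (\sum_(1 <= k < M') _) hM => b.
  by move: (\sum_(1 <= k < M) _) => a hM ab; lra.
apply: le_trans L1 _.
rewrite (@big_cat_nat _ _ _ M' 1 (2 * M' + 1))//=; last first.
  by rewrite mul2n -addnn -addnA leq_addr.
rewrite mulr_sumr -[leLHS]addr0; apply: lerD.
  rewrite !big_nat; apply: ler_sum => k /andP[k0 kM].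
  rewrite /F_term mulrC ler_pM2l ?jordan_coef_gt0// /q.
  apply: lerXn2r; rewrite ?nnegrE ?sqrtr_ge0//; apply: ler_wsqrtr.
  have k1 : k%:R / M'%:R <= 1 :> R by rewrite ler_pdivrMr// mul1r ler_nat ltnW.
  have k2 : 0 <= k%:R / M'%:R :> R by rewrite divr_ge0// ltW.
  have -> : (k%:R / y) ^+ 2 = x / 4 * (k%:R / M'%:R) ^+ 2.
    rewrite /y -{2}(sqr_sqrtr (ltW x0)); field.
    by rewrite !gt_eqF.
  have k3 : x / 4 * (k%:R / M'%:R) ^+ 2 <= x / 4 * 1.
    by rewrite ler_wpM2l ?exprn_ile1// divr_ge0// ltW.
  by move: (_ * _ ^+ 2) k3 => t; lra.
rewrite big_nat; apply: sumr_ge0 => k /andP[kM _].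
rewrite mulr_ge0 ?exprn_ge0 ?sqrtr_ge0// ltW// jordan_coef_gt0//.
by rewrite (leq_trans _ kM).
Qed.

Lemma level_gt0 : 0 < level R m.+1.
Proof. by rewrite levelE invr_gt0 ball_volume_gt0. Qed.

Lemma F_level_unique x y1 y2 : 0 < x -> 0 < y1 -> 0 < y2 ->
  F m.+1 x y1 = level R m.+1 -> F m.+1 x y2 = level R m.+1 -> y1 = y2.
Proof.
move=> x0 y10 y20 F1 F2; have l0 := level_gt0.
have [y12|y12|//] := ltgtP y1 y2.
- by have := @F_lt_of_gt0 _ _ _ x0 y10 y12; rewrite F1 F2 ltxx => /(_ l0).
- by have := @F_lt_of_gt0 _ _ _ x0 y20 y12; rewrite F1 F2 ltxx => /(_ l0).
Qed.

(** Intermediate values between [1 / Num.sqrt x], where [F] vanishes, and a point where it reaches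
    the level; the default value in [Y] therefore never occurs. *)
Lemma Y_spec x : 0 < x -> 0 < Y m.+1 x /\ F m.+1 x (Y m.+1 x) = level R m.+1.
Proof.
move=> x0; apply: (@xgetPex _ 0 [set y | 0 < y /\ F m.+1 x y = level R m.+1]).
have sx0 : 0 < 1 / Num.sqrt x by rewrite divr_gt0// sqrtr_gt0.
have [y1 y10 Ly1] := F_unbounded (level R m.+1) x0.
have y1s : 1 / Num.sqrt x <= y1.
  rewrite leNgt; apply/negP => /ltW/(F_eq0 x0 y10) F0.
  by move: Ly1; rewrite F0 leNgt level_gt0.
have [||y] := @IVT R (F m.+1 x) _ _ (level R m.+1) y1s.
- apply: continuous_in_subspaceT => y; rewrite inE/= in_itv/= => /andP[h _].
  by apply: continuous_F_y; rewrite // in_itv/= (lt_le_trans sx0).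
- rewrite F_eq0// ge_min le_max Ly1 orbT andbT.
  by rewrite ltW// level_gt0.
rewrite in_itv/= => /andP[h _] Fy; exists y; split => //.
exact: lt_le_trans h.
Qed.

(** [F] lies strictly below the level at [y0 - d] and strictly above it at [y0 + d]. Continuity in
    [x] preserves both inequalities near [x0], and monotonicity in [y] then traps [Y] between the
    two points. *)
Lemma continuous_Y : {in `]0, +oo[, continuous (Y m.+1 : R -> R)}.
Proof.
move=> x0; rewrite in_itv/= andbT => x00.
have [Y0 FY] := Y_spec x00; have l0 := level_gt0.
apply/cvgrPdist_lt => e e0; move: (Y m.+1 x0) Y0 FY => y0 Y0 FY.
pose d := Num.min e (y0 / 2).
have d0 : 0 < d by rewrite lt_min e0 divr_gt0.
have de : d <= e by rewrite ge_min lexx.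
have dY : d <= y0 / 2 by rewrite ge_min lexx orbT.
have ym0 : 0 < y0 - d by lra.
have yp0 : 0 < y0 + d by lra.
have Fm : F m.+1 x0 (y0 - d) < level R m.+1.
  by rewrite -FY; apply: F_lt_of_gt0; rewrite ?FY//; lra.
have Fp : level R m.+1 < F m.+1 x0 (y0 + d).
  rewrite -FY; apply: F_lt_of_gt0; rewrite ?FY//; first lra.
  apply: lt_le_trans l0 _; rewrite -FY; apply: F_le => //; lra.
have x0in : x0 \in `]0, +oo[ by rewrite in_itv/= x00.
near=> x.
have x_gt0 : 0 < x by near: x; exact: lt_nbhsr.
have [Yx0 FYx] := Y_spec x_gt0.
have Fxm : F m.+1 x (y0 - d) < level R m.+1.
  by near: x; apply: (cvgr_lt _ (continuous_F_x ym0 x0in)).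
have Fxp : level R m.+1 < F m.+1 x (y0 + d).
  by near: x; apply: (cvgr_gt _ (continuous_F_x yp0 x0in)).
have h1 : y0 - d < Y m.+1 x.
  rewrite ltNge; apply/negP => h.
  by have := F_le x_gt0 (lexx x) Yx0 h; rewrite FYx leNgt Fxm.
have h2 : Y m.+1 x < y0 + d.
  rewrite ltNge; apply/negP => h.
  by have := F_le x_gt0 (lexx x) yp0 h; rewrite FYx leNgt Fxp.
by rewrite (lt_le_trans _ de)// ltr_distlC h1 h2.
Unshelve. all: by end_near. Qed.

End LevelFunction.

(** * Shortest vectors and primitive vectors *)

(** A duplicate-free list of maximal length must contain every element satisfying [P]. This turns
    the bound of [count_qform_lt] into an explicit finite list of short vectors. *)
Lemma finite_enum (T : eqType) (P : T -> Prop) (N : nat) :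
  (forall s : seq T, uniq s -> {in s, forall x, P x} -> (size s <= N)%N) ->
  exists s : seq T, forall x, x \in s <-> P x.
Proof.
move=> bound.
pose Q k := `[< exists s : seq T,
  [/\ uniq s, {in s, forall x, P x} & size s = k] >].
have Q0 : exists k, Q k by exists 0%N; apply/asboolP; exists [::].
have Qle k : Q k -> (k <= N)%N by move=> /asboolP[s [us sP <-]]; exact: bound.
case: (ex_maxnP Q0 Qle) => k /asboolP[s [us sP sk]] kmax.
exists s => x; split; first exact: sP.
move=> Px; apply: contrapT => /negP xs.
suff /kmax : Q k.+1 by rewrite ltnn.
apply/asboolP; exists (x :: s); split; rewrite /= ?xs ?sk//.
by move=> z; rewrite inE => /predU1P[->|/sP].
Qed.

Lemma seq_argmin (R : realType) (T : eqType) (f : T -> R) (x : T) (s : seq T) :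
  exists2 a, a \in x :: s & {in x :: s, forall b, f a <= f b}.
Proof.
elim: s x => [|y s IH] x.
  by exists x => [|b]; rewrite inE// => /eqP ->.
have [a ays amin] := IH y.
have [fxa|fax] := leP (f x) (f a).
  exists x; first by rewrite inE eqxx.
  by move=> b; rewrite inE => /predU1P[->//|/amin]; exact: le_trans.
exists a; first by rewrite inE ays orbT.
by move=> b; rewrite inE => /predU1P[->|/amin//]; exact: ltW.
Qed.

Section Lattice.
Variable R : realType.

Lemma sqnormE m (v : 'rV[R]_m) : sqnorm v = (v *m v^T) 0 0.
Proof. by rewrite mxE; apply: eq_bigr => i _; rewrite mxE expr2. Qed.

Lemma sqnorm_ge0 m (v : 'rV[R]_m) : 0 <= sqnorm v.
Proof. by apply: sumr_ge0 => i _; exact: sqr_ge0. Qed.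

Lemma sqnorm_gt0 m (v : 'rV[R]_m) : v != 0 -> 0 < sqnorm v.
Proof.
move=> v0; rewrite lt_neqAle sqnorm_ge0 andbT eq_sym.
apply: contraNneq v0 => /eqP; rewrite psumr_eq0 => [|i _]; last exact: sqr_ge0.
move=> /allP vi; apply/eqP/rowP => i; rewrite mxE.
by have := vi i (mem_index_enum _); rewrite sqrf_eq0 => /eqP.
Qed.

Lemma sqnormZ m (a : R) (v : 'rV[R]_m) : sqnorm (a *: v) = a ^+ 2 * sqnorm v.
Proof.
by rewrite /sqnorm mulr_sumr; apply: eq_bigr => i _; rewrite mxE exprMn.
Qed.

Lemma sqnorm_row_mx m1 m2 (u : 'rV[R]_m1) (v : 'rV[R]_m2) :
  sqnorm (row_mx u v) = sqnorm u + sqnorm v.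
Proof.
rewrite /sqnorm big_split_ord/=; congr (_ + _); apply: eq_bigr => i _.
  by rewrite row_mxEl.
by rewrite row_mxEr.
Qed.

Lemma qform_gram m (B : 'M[R]_m) v : qform (B *m B^T) v = sqnorm (v *m B).
Proof. by rewrite sqnormE trmx_mul /qform !mulmxA. Qed.

Lemma mulmx_unit_eq0 m (B : 'M[R]_m) (v : 'rV[R]_m) :
  B \in unitmx -> (v *m B == 0) = (v == 0).
Proof.
move=> Bu; apply/eqP/eqP => [vB|->]; last by rewrite mul0mx.
by rewrite -(mulmxK Bu v) vB mul0mx.
Qed.

Lemma posdef_gram m (B : 'M[R]_m) : B \in unitmx -> posdef (B *m B^T).
Proof.
move=> Bu; split; first by rewrite trmx_mul trmxK.
by move=> v v0; rewrite qform_gram sqnorm_gt0// mulmx_unit_eq0.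
Qed.

Lemma map_intr_eq0 m (z : 'rV[int]_m) :
  (map_mx (intr : int -> R) z == 0) = (z == 0).
Proof.
apply/eqP/eqP => [/rowP z0|->]; last by rewrite map_mx0.
apply/rowP => i; have := z0 i.
by rewrite !mxE => /eqP; rewrite intr_eq0 => /eqP.
Qed.

Lemma shortest_vectors_nonempty m (B : 'M[R]_m) : (0 < m)%N -> B \in unitmx ->
  shortest_vectors B !=set0.
Proof.
move=> m0 Bu.
pose f (z : 'rV[int]_m) := sqnorm (map_mx intr z *m B).
pose z1 : 'rV[int]_m := const_mx 1.
have z1n0 : z1 != 0.
  apply/negP => /eqP/rowP/(_ (Ordinal m0)).
  by rewrite !mxE => /eqP; rewrite oner_eq0.
(* The added 1 makes [z1] itself satisfy the strict bound, so the list of candidates is nonempty. *)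
pose T := Num.sqrt (f z1 + 1).
have fT : T ^+ 2 = f z1 + 1 by rewrite sqr_sqrtr// addr_ge0// sqnorm_ge0.
have [_ [K K0 cnt]] := count_qform_lt (posdef_gram Bu).
have [|s sP] := @finite_enum _ (fun z : 'rV[int]_m => z != 0 /\ f z < T ^+ 2)
    (Num.truncn (ball_volume R m / Num.sqrt (\det (B *m B^T)) * T ^+ m
                   + K * (m%:R * (T + 1) ^+ m.-1))).
  move=> s us sP; apply: (@leq_trans (Num.truncn ((size s)%:R : R))).
    by rewrite natrK.
  apply: le_truncn; apply: (cnt T 0) => //; first exact: sqrtr_ge0.
  by move=> z /sP[_]; rewrite addr0 qform_gram.
have z1s : z1 \in s by apply/sP; split => //; rewrite fT ltrDl.
case: s sP z1s => [//|z0 s] sP z1s.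
have [z /[dup] zs /sP[zn0 zT] zmin] := seq_argmin f z0 s.
exists (map_mx intr z *m B); split.
- by exists z.
- by rewrite mulmx_unit_eq0// map_intr_eq0.
move=> _ [z' ->]; rewrite mulmx_unit_eq0// map_intr_eq0 => z'n0.
rewrite -/(f z) -/(f z'); have [z'T|Tz'] := ltP (f z') (T ^+ 2).
  by apply: zmin; apply/sP.
by apply: le_trans Tz'; exact: ltW.
Qed.

Lemma lattice_minP m (B : 'M[R]_m) : (0 < m)%N -> B \in unitmx ->
  exists2 v, shortest_vectors B v & lattice_min B = sqnorm v.
Proof.
move=> m0 Bu; have [v vB] := shortest_vectors_nonempty m0 Bu.
have : ((@sqnorm R m) @` shortest_vectors B) (lattice_min B).
  by apply: xgetPex; exists (sqnorm v), v.
by move=> [v' v'B <-]; exists v'.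
Qed.

Lemma lattice_min_le m (B : 'M[R]_m) (z : 'rV[int]_m) : (0 < m)%N ->
  B \in unitmx -> z != 0 -> lattice_min B <= sqnorm (map_mx intr z *m B).
Proof.
move=> m0 Bu z0; have [v [_ _ vmin] ->] := lattice_minP m0 Bu.
by apply: vmin; [exists z|rewrite mulmx_unit_eq0// map_intr_eq0].
Qed.

Lemma le_lattice_min m (B : 'M[R]_m) (r : R) : (0 < m)%N -> B \in unitmx ->
  (forall z : 'rV[int]_m, z != 0 -> r <= sqnorm (map_mx intr z *m B)) ->
  r <= lattice_min B.
Proof.
move=> m0 Bu rB; have [v [[z zE] v0 _] ->] := lattice_minP m0 Bu.
by rewrite zE rB// -map_intr_eq0 -(mulmx_unit_eq0 _ Bu) -zE.
Qed.

Definition gcd_row m (k : nat) (z : 'rV[int]_m) : nat :=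
  gcdn k (\big[gcdn/0%N]_i `|z 0%R i|%N).

Lemma dvdn_gcd_row m (k d : nat) (z : 'rV[int]_m) :
  reflect ((d %| k)%N /\ forall i, (d %| `|z 0%R i|)%N) (d %| gcd_row k z)%N.
Proof.
rewrite dvdn_gcd; apply: (iffP andP) => -[dk dz]; split => //.
  by move=> i; move/dvdn_biggcdP: dz => /(_ i isT).
by apply/dvdn_biggcdP => i _; exact: dz.
Qed.

(** A short vector has [k != 0], as otherwise it would be a short vector of the lattice of [B].
    Changing its sign makes [k] positive, and dividing by the gcd of all coordinates only shortens
    it. *)
Lemma primitive_vector m (B : 'M[R]_m) (a : 'rV[R]_m) (y r : R) (k : int)
    (z : 'rV[int]_m) :
  (forall z : 'rV[int]_m, z != 0 -> r <= sqnorm (map_mx intr z *m B)) ->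
  (k != 0) || (z != 0) ->
  (k%:~R / y) ^+ 2 + sqnorm ((map_mx intr z + k%:~R *: a) *m B) < r ->
  exists k' : nat, exists z' : 'rV[int]_m, gcd_row k'.+1 z' = 1%N /\
    (k'.+1%:R / y) ^+ 2 + sqnorm ((map_mx intr z' + k'.+1%:R *: a) *m B) < r.
Proof.
move=> Br kz0 kzr.
have {kz0} kn0 : k != 0.
  apply: contraTneq kz0 => k0; rewrite k0 eqxx/= negbK.
  apply: contraTT kzr => zn0.
  by rewrite k0 mul0r expr0n/= add0r scale0r addr0 -leNgt Br.
wlog k0 : k z kn0 kzr / 0 < k => [wl|].
  move: (kn0); rewrite neq_lt => /orP[kneg|]; last exact: wl kzr.
  apply: (wl (- k) (- z)); rewrite ?oppr_eq0 ?oppr_gt0//.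
  have -> : map_mx intr (- z) + (- k)%:~R *: a
      = -1 *: (map_mx intr z + k%:~R *: a).
    by rewrite map_mxN mulrNz scaleNr scaleN1r opprD.
  by rewrite -scalemxAl sqnormZ mulrNz mulNr !sqrrN expr1n mul1r.
case: k k0 {kn0} kzr => // k; rewrite ltz_nat => k0 kzr.
pose d := gcd_row k z.
have d0 : (0 < d)%N by rewrite gcdn_gt0 k0.
have [/dvdnP[k' kE] dz] := elimT (dvdn_gcd_row k d z) (dvdnn d).
have k'0 : (0 < k')%N by move: k0; rewrite kE muln_gt0 => /andP[].
pose z' : 'rV[int]_m := \row_i (z 0%R i %/ d)%Z.
have zE i : z 0 i = z' 0 i * d%:Z by rewrite mxE divzK// dvdzE; exact: dz.
exists k'.-1, z'; rewrite prednK//; split.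
  (* If [e] is the gcd of the quotients, then [e * d] divides [k] and all [z i], hence divides [d],
     so [e = 1]. *)
  have e1 := elimT (dvdn_gcd_row k' (gcd_row k' z') z') (dvdnn _).
  have : (gcd_row k' z' * d %| d)%N.
    apply/dvdn_gcd_row; split; first by rewrite kE dvdn_mul//; exact: e1.1.
    by move=> i; rewrite zE abszM dvdn_mul//; exact: e1.2.
  by rewrite -[X in (_ %| X)%N]mul1n dvdn_pmul2r// dvdn1 => /eqP.
apply: le_lt_trans kzr.
have -> : map_mx intr z + (Posz k)%:~R *: a
    = d%:R *: (map_mx intr z' + k'%:R *: a).
  apply/rowP => i; rewrite !mxE -/(z' 0 i) zE kE rmorphM/= mulrDr mulrA.
  rewrite mulzK ?eqz_nat -?lt0n// -!pmulrn natrM.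
  by move: (_%:~R) => t; ring.
rewrite -scalemxAl sqnormZ.
have -> : (Posz k)%:~R / y = d%:R * (k'%:R / y).
  by rewrite kE -pmulrn natrM; ring.
rewrite [(d%:R * _) ^+ 2]exprMn -mulrDr.
rewrite -[leLHS]mul1r ler_wpM2r ?addr_ge0 ?sqr_ge0 ?sqnorm_ge0//.
by rewrite exprn_ege1// ler1n.
Qed.

End Lattice.

(** * Averaging over the division points of the torus *)

Section Averaging.
Variables (R : realType) (m : nat).
Hypothesis m_gt0 : (0 < m)%N.

Definition residue (k : nat) (z : 'rV[int]_m) : {ffun 'I_m -> 'I_k.+1} :=
  [ffun i => inord `|(z 0%R i %% k.+1)%Z|%N].

Lemma residueE k (z : 'rV[int]_m) i :
  (residue k z i : nat)%:Z = (z 0%R i %% k.+1)%Z.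
Proof.
have h0 : 0 <= (z 0%R i %% k.+1)%Z by rewrite modz_ge0.
rewrite ffunE inordK ?gez0_abs//.
by rewrite -ltz_nat gez0_abs// ltz_pmod.
Qed.

Lemma residue_primitive k (z : 'rV[int]_m) : gcd_row k.+1 z = 1%N ->
  residue k z \in primitive_residues m k.+1.
Proof.
move=> g1; rewrite inE -dvdn1 -g1; apply/dvdn_gcd_row.
have := dvdnn (gcd_family (residue k z)); rewrite dvdn_gcd_family.
set d := gcd_family _ => /andP[dk /forallP dz]; split => // i.
have : (d %| (residue k z i : nat)%:Z)%Z by rewrite dvdzE; exact: dz.
rewrite residueE => h; have : (d %| z 0%R i)%Z.
  by rewrite (divz_eq (z 0 i) k.+1) rpredD// dvdz_mull// dvdzE.
by rewrite dvdzE.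
Qed.

(** The [N]-division points of the torus, in coordinates with respect to the basis [B]. *)
Definition frac_shift (N : nat) (w : {ffun 'I_m -> 'I_N}) : 'rV[R]_m :=
  \row_i ((w i : nat)%:R / N%:R).

(* For [z] in the class [rho], the vectors [z + k w / N] are the points
   [(k / N) (u + N rho / k)] with [u] integral, and [u] determines [w] modulo
   [N]: all of them lie in one translate of the lattice, where
   [count_qform_lt] applies. *)
Lemma count_fiber (B : 'M[R]_m) : B \in unitmx -> \det (B *m B^T) = 1 ->
  exists2 K : R, 0 <= K & forall (N k : nat) (rho : {ffun 'I_m -> 'I_k.+1})
      (y r : R) (s : seq {ffun 'I_m -> 'I_N})
      (z : {ffun 'I_m -> 'I_N} -> 'rV[int]_m),
    (0 < N)%N -> 0 < r -> uniq s ->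
    {in s, forall w, residue k (z w) = rho} ->
    {in s, forall w, (k.+1%:R / y) ^+ 2
       + sqnorm ((map_mx intr (z w) + k.+1%:R *: frac_shift w) *m B) < r} ->
    (size s)%:R <= N%:R ^+ m * (ball_volume R m / k.+1%:R ^+ m
                      * Num.sqrt (r - (k.+1%:R / y) ^+ 2) ^+ m)
                   + K * (N%:R * (Num.sqrt r + 1)) ^+ m.-1.
Proof.
move=> Bu dB; have [_ [K K0 cnt]] := count_qform_lt (posdef_gram Bu).
exists (K * m%:R); first by rewrite mulr_ge0.
move=> N k rho y r s z N0 r0 us sres sshort.
have Nr0 : 0 < N%:R :> R by rewrite ltr0n.
have Nr1 : 1 <= N%:R :> R by rewrite ler1n.
have kr0 : 0 < k.+1%:R :> R by rewrite ltr0n.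
pose S := Num.sqrt (r - (k.+1%:R / y) ^+ 2).
have S0 : 0 <= S by exact: sqrtr_ge0.
have Sr : S <= Num.sqrt r by apply: ler_wsqrtr; rewrite gerBl sqr_ge0.
pose T := N%:R / k.+1%:R * S.
have T0 : 0 <= T by rewrite mulr_ge0// divr_ge0// ltW.
pose q w i := (z w 0%R i %/ k.+1)%Z.
pose u w : 'rV[int]_m := \row_i (q w i * N%:Z + (w i : nat)%:Z).
pose c : 'rV[R]_m := \row_i (N%:R / k.+1%:R * (rho i : nat)%:R).
have uE w : w \in s ->
    map_mx intr (u w) + c
      = (N%:R / k.+1%:R) *: (map_mx intr (z w) + k.+1%:R *: frac_shift w).
  move=> ws; apply/rowP => i; rewrite !mxE.
  have -> : z w 0 i = q w i * k.+1%:Z + (rho i : nat)%:Z.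
    by rewrite -(sres _ ws) residueE -divz_eq.
  rewrite !rmorphD !rmorphM/= -!pmulrn.
  by field; rewrite !gt_eqF.
have := cnt T c (map u s) T0; rewrite size_map dB sqrtr1 divr1.
move=> /(_ _ _)/le_trans; apply.
- rewrite map_inj_in_uniq// => w w' ws w's /rowP uw; apply/ffunP => i.
  have := uw i; rewrite !mxE => /(congr1 (modz^~ N%:Z)).
  rewrite !modzMDl !modz_small ?ltz_nat ?ltn_ord ?lez_nat//.
  by move=> [/val_inj].
- move=> _ /mapP[w ws ->]; rewrite qform_gram uE// -scalemxAl sqnormZ.
  have -> : T ^+ 2 = (N%:R / k.+1%:R) ^+ 2 * S ^+ 2 by rewrite /T exprMn.
  rewrite ltr_pM2l ?exprn_gt0 ?divr_gt0//.
  rewrite sqr_sqrtr; first by rewrite ltrBrDl sshort.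
  rewrite subr_ge0 ltW// (le_lt_trans _ (sshort _ ws))//.
  by rewrite lerDl sqnorm_ge0.
apply: lerD.
  rewrite /T -/S !exprMn exprVn.
  by rewrite le_eqVlt; apply/orP; left; apply/eqP; ring.
rewrite mulrA; apply: ler_wpM2l; first by rewrite mulr_ge0.
apply: lerXn2r; rewrite ?nnegrE ?addr_ge0 ?mulr_ge0 ?sqrtr_ge0//.
rewrite mulrDr mulr1; apply: lerD => //.
rewrite /T -mulrA ler_pM2l// -[leRHS]mul1r ler_pM ?invr_ge0//.
by rewrite invf_le1// ler1n.
Qed.

(** If every translation failed, each of the [N ^ m] division points would have a short primitive
    vector. Sorting these points by [k] and by the residue class of [z] bounds their number by
    [N ^ m * (V * F)] plus an error of order [N ^ m.-1], which is less than [N ^ m] for large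
    [N]. *)
Lemma exists_translation (B : 'M[R]_m) (y r : R) : B \in unitmx ->
  \det (B *m B^T) = 1 -> 0 < y -> 0 < r ->
  (forall z : 'rV[int]_m, z != 0 -> r <= sqnorm (map_mx intr z *m B)) ->
  F m.+1 r y < level R m.+1 ->
  exists a : 'rV[R]_m, forall (k : int) (z : 'rV[int]_m),
    (k != 0) || (z != 0) ->
    r <= (k%:~R / y) ^+ 2 + sqnorm ((map_mx intr z + k%:~R *: a) *m B).
Proof.
move=> Bu dB y0 r0 Br Flt; have [K K0 cnt] := count_fiber Bu dB.
apply: contrapT => noa.
have sr0 : 0 < Num.sqrt r by rewrite sqrtr_gt0.
pose M := Num.truncn (Num.sqrt r * y).
have xyM : Num.sqrt r * y < M.+1%:R by exact: truncnS_gt.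
have V0 := ball_volume_gt0 R m; set V := ball_volume R m in V0 *.
have VF : V * F m.+1 r y < 1.
  by move: Flt; rewrite levelE -/V -div1r ltr_pdivlMr// mulrC.
pose E := (Num.sqrt r + 1) ^+ m.-1.
(* [P] is the number of classes, each of which contributes an error [K * E * N ^ m.-1]; [N] is
   chosen so that the total error stays below the gap [N ^ m * (1 - V * F)]. *)
pose P : R := \sum_(k < M) #|primitive_residues m k.+1|%:R.
pose Ctot := P * (K * E).
pose N := (Num.truncn (Ctot / (1 - V * F m.+1 r y))).+1.
have Nbig : Ctot < N%:R * (1 - V * F m.+1 r y).
  by rewrite -ltr_pdivrMr ?subr_gt0//; exact: truncnS_gt.
have N0 : (0 < N)%N by [].
have Nr0 : 0 < N%:R :> R by rewrite ltr0n.
have short (w : {ffun 'I_m -> 'I_N}) : exists kz : nat * 'rV[int]_m,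
    gcd_row kz.1.+1 kz.2 = 1%N /\ (kz.1.+1%:R / y) ^+ 2
      + sqnorm ((map_mx intr kz.2 + kz.1.+1%:R *: frac_shift w) *m B) < r.
  apply: contrapT => nokz; apply: noa; exists (frac_shift w) => k z kz0.
  rewrite leNgt; apply/negP => /(primitive_vector Br kz0)[k' [z' h]].
  by apply: nokz; exists (k', z').
(* Choosing a single vector for each point makes the classes [cl k rho] a partition of all the
   points, whence the equality [tot]. *)
have [kz kzP] := choice short.
have kM w : ((kz w).1 < M)%N.
  rewrite truncn_ge_nat ?mulr_ge0 ?(ltW y0) ?(ltW sr0)//.
  rewrite -ler_pdivrMr//; have [_ h] := kzP w.
  have /ltW : ((kz w).1.+1%:R / y) ^+ 2 < r.
    by apply: le_lt_trans h; rewrite lerDl sqnorm_ge0.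
  move=> /ler_wsqrtr; rewrite sqrtr_sqr ger0_norm//.
  by rewrite divr_ge0// ltW.
pose cl (k : 'I_M) (rho : {ffun 'I_m -> 'I_k.+1}) :=
  [seq w <- enum {ffun 'I_m -> 'I_N} |
     ((kz w).1 == k) && (residue k (kz w).2 == rho)].
have tot : (N ^ m)%N = (\sum_(k < M) \sum_(rho in primitive_residues m k.+1)
    size (cl k rho))%N.
  rewrite -[N in LHS]card_ord -[m in LHS]card_ord -card_ffun.
  transitivity (\sum_(w : {ffun 'I_m -> 'I_N}) \sum_(k < M)
      \sum_(rho in primitive_residues m k.+1)
      (((kz w).1 == k) && (residue k (kz w).2 == rho)))%N.
    rewrite -sum1_card; apply: eq_bigr => w _.
    rewrite (bigD1 (Ordinal (kM w)))//=.
    rewrite (bigD1 (residue (kz w).1 (kz w).2))/=; last first.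
      by apply: residue_primitive; exact: (kzP w).1.
    rewrite !eqxx/= [X in (_ + X + _)%N]big1 ?[X in (_ + _ + X)%N]big1//.
      move=> k /eqP kn; rewrite big1// => rho _.
      case: eqP => //= kE; case: kn; exact: val_inj.
    by move=> rho /andP[_ /negbTE]; rewrite eq_sym => ->.
  rewrite exchange_big/=; apply: eq_bigr => k _.
  rewrite exchange_big/=; apply: eq_bigr => rho _.
  rewrite size_filter -sum1_count big_enum_cond/= [RHS]big_mkcond/=.
  by apply: eq_bigr => w _; case: ifP.
have bnd (k : 'I_M) (rho : {ffun 'I_m -> 'I_k.+1}) :
    (size (cl k rho))%:R <= N%:R ^+ m * (V / k.+1%:R ^+ m
        * Num.sqrt (r - (k.+1%:R / y) ^+ 2) ^+ m) + K * (E * N%:R ^+ m.-1).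
  rewrite /E -exprMn [(_ + 1) * _]mulrC.
  apply: (cnt N k rho y r (cl k rho) (fun w => (kz w).2)) => //.
  - by rewrite filter_uniq// enum_uniq.
  - by move=> w; rewrite mem_filter => /andP[/andP[_ /eqP ->]].
  - move=> w; rewrite mem_filter => /andP[/andP[/eqP kE _] _].
    by rewrite -kE; exact: (kzP w).2.
have : N%:R ^+ m <= N%:R ^+ m * (V * F m.+1 r y) + Ctot * N%:R ^+ m.-1 :> R.
  rewrite -[leLHS]natrX tot natr_sum (F_truncE m_gt0 r0 y0 xyM).
  rewrite big_add1/= big_mkord !mulr_sumr /Ctot /P !mulr_suml -big_split/=.
  apply: ler_sum => k _; rewrite natr_sum.
  apply: le_trans (ler_sum _ (fun rho _ => bnd k rho)) _.
  rewrite sumr_const -[leLHS]mulr_natl mulrDr; apply: lerD; last first.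
    by rewrite le_eqVlt; apply/orP; left; apply/eqP; ring.
  rewrite card_primitive_residues// /F_term.
  have kr0 : 0 < k.+1%:R ^+ m :> R by rewrite exprn_gt0// ltr0n.
  move: (k.+1%:R ^+ m) kr0 (jordan_coef _ _ _) (Num.sqrt _ ^+ m) (N%:R ^+ m).
  move=> t t0 J S X.
  by rewrite le_eqVlt; apply/orP; left; apply/eqP; field; rewrite gt_eqF.
apply/negP; rewrite -ltNge -ltrBrDl.
have -> : N%:R ^+ m = N%:R * N%:R ^+ m.-1 :> R by rewrite -exprS prednK.
rewrite [ltRHS](_ : _ = N%:R * (1 - V * F m.+1 r y) * N%:R ^+ m.-1); last first.
  by move: (V * F _ _ _) => t; ring.
by rewrite ltr_pM2r// exprn_gt0.
Qed.

Lemma hermite_constant_ge (B : 'M[R]_m) (y r : R) : B \in unitmx ->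
  \det (B *m B^T) = 1 -> 0 < y -> 0 < r ->
  (forall z : 'rV[int]_m, z != 0 -> r <= sqnorm (map_mx intr z *m B)) ->
  F m.+1 r y < level R m.+1 ->
  ((r * y `^ (2 / m.+1%:R))%:E <= hermite_constant R m.+1)%E.
Proof.
move=> Bu dB y0 r0 Br Flt.
have [a aP] := exists_translation Bu dB y0 r0 Br Flt.
(* The first row is the lattice vector of height [1 / y] lying over the translation; as [B] has Gram
   determinant 1, that of [A] is [y ^ -2]. *)
pose A : 'M[R]_(1 + m) := block_mx (y^-1)%:M (a *m B) 0 B.
have dA : \det A = y^-1 * \det B by rewrite det_ublock det_scalar1.
have dB2 : \det B ^+ 2 = 1 by rewrite -dB det_mulmx det_tr expr2.
have Au : A \in unitmx.
  have dBn0 : \det B != 0 by rewrite -unitfE -unitmxE.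
  by rewrite unitmxE dA unitfE mulf_neq0// invr_neq0// gt_eqF.
have A1 : lattice_det A = y^-1 ^+ 2.
  by rewrite /lattice_det det_mulmx det_tr -expr2 dA exprMn dB2 mulr1.
have rA : r <= lattice_min A.
  apply: le_lattice_min => // z z0.
  have zE := hsubmxK (z : 'rV[int]_(1 + m)).
  pose k := lsubmx (z : 'rV[int]_(1 + m)) 0 0.
  have kE : lsubmx (z : 'rV[int]_(1 + m)) = k%:M by rewrite [LHS]mx11_scalar.
  have := aP k (rsubmx (z : 'rV[int]_(1 + m))).
  have -> : (k != 0) || (rsubmx (z : 'rV[int]_(1 + m)) != 0).
    rewrite -negb_and; apply: contra z0 => /andP[/eqP k0 /eqP z20].
    rewrite -zE kE k0 z20 (_ : 0%:M = 0 :> 'M[int]_1) ?row_mx0//.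
    by apply/matrixP => i j; rewrite !mxE mul0rn.
  move=> /(_ isT)/le_trans; apply.
  rewrite -[X in _ <= sqnorm (map_mx _ X *m _)]zE map_row_mx mul_row_block.
  rewrite sqnorm_row_mx mulmx0 addr0.
  rewrite kE map_scalar_mx/= -scalar_mxM mul_scalar_mx scalemxAl -mulmxDl.
  rewrite [_ *: a + _]addrC lerD2r.
  by rewrite /sqnorm big_ord1 mxE eqxx mulr1n.
apply: (@le_trans _ _ (lattice_min A / lattice_det A `^ m.+1%:R^-1)%:E);
  last first.
  by apply: ereal_sup_ubound; exists A.
rewrite lee_fin A1.
have -> : (y^-1 ^+ 2) `^ m.+1%:R^-1 = (y `^ (2 / m.+1%:R))^-1.
  rewrite -powR_mulrn ?invr_ge0 ?(ltW y0)// -powRrM -powRN.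
  by rewrite -powR_inv1 ?(ltW y0)// -powRrM mulN1r.
by rewrite invrK ler_wpM2r// powR_ge0.
Qed.

(** The strict inequality gives a lattice exceeding [r] whether or not the supremum is attained;
    scaling by the factor [D ^ (-1 / (2 m))] brings its Gram determinant [D] to 1. *)
Lemma normalized_lattice (r : R) : 0 < r -> (r%:E < hermite_constant R m)%E ->
  exists B : 'M[R]_m, [/\ B \in unitmx, \det (B *m B^T) = 1 &
    forall z : 'rV[int]_m, z != 0 -> r <= sqnorm (map_mx intr z *m B)].
Proof.
move=> r0 /ereal_sup_gt[_ [B0 B0u <-]]; rewrite lte_fin => rB0.
pose D := lattice_det B0.
have D0 : 0 < D by have [] := count_qform_lt (posdef_gram B0u).
pose d := D `^ m%:R^-1; have d0 : 0 < d by exact: powR_gt0.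
have dm : d ^+ m = D.
  rewrite -powR_mulrn ?(ltW d0)// -powRrM mulVf ?powRr1 ?(ltW D0)//.
  by rewrite pnatr_eq0 -lt0n.
pose a := Num.sqrt d^-1.
have a2 : a ^+ 2 = d^-1 by rewrite sqr_sqrtr// invr_ge0 ltW.
have a0 : a != 0 by rewrite gt_eqF// sqrtr_gt0 invr_gt0.
exists (a *: B0); split.
- by rewrite unitmxE detZ unitfE mulf_neq0 ?expf_neq0// -unitfE -unitmxE.
- rewrite linearZ/= -scalemxAl -scalemxAr scalerA -expr2 a2 detZ exprVn dm.
  by rewrite mulVf// gt_eqF.
move=> z z0; rewrite -scalemxAr sqnormZ a2 mulrC ler_pdivlMr//.
apply: le_trans (lattice_min_le m_gt0 B0u z0).
by rewrite -ler_pdivlMr// ltW.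
Qed.

End Averaging.

(** * Passage from strict inequalities to the supremum *)

Theorem theorem2 (R : realType) (n : nat) (hn : (2 <= n)%N) :
  [/\ (forall x : R, 0 < x ->
        [/\ {in `]0, +oo[, continuous (F n x)},
            (forall y : R, 0 < y -> y <= 1 / Num.sqrt x -> F n x y = 0) &
            (forall y1 y2 : R, 1 / Num.sqrt x < y1 -> y1 < y2 ->
               F n x y1 < F n x y2)]),
      (forall x : R, 0 < x ->
        [/\ 0 < Y n x, F n x (Y n x) = level R n &
            (forall y : R, 0 < y -> F n x y = level R n -> y = Y n x)]),
      {in `]0, +oo[, continuous (Y n : R -> R)} &
      (forall g : R, 0 < g -> (g%:E <= hermite_constant R n.-1)%E ->
         (C n g <= hermite_constant R n)%E)].
Proof.
case: n hn => [//|m]; rewrite ltnS => m0; split.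
- move=> x x0; split; first exact: continuous_F_y.
    by move=> y; exact: F_eq0.
  by move=> y1 y2; exact: F_lt.
- move=> x x0; have [Y0 FY] := Y_spec m0 x0; split => // y y0 Fy.
  by apply: (F_level_unique m0 x0); rewrite // FY.
- exact: continuous_Y.
move=> g g0 gle; apply: ge_ereal_sup => z [xi].
rewrite /= in_itv/= => /andP[xi0 xig] <-{z}.
have [Y0 FY] := Y_spec m0 xi0.
set c := xi * _; have c0 : 0 < c by rewrite mulr_gt0// powR_gt0.
(* At [xi] and [Y xi] the function equals the level, and [xi] may equal the Hermite constant.
   Multiplying both by [t < 1] makes the two inequalities strict, at a cost of at most [e]. *)
apply/lee_subgt0Pr => e e0.
(* The bound [2^-1] keeps [t = 1 - d] positive. The other makes [2 * d * c <= e], which suffices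
   because [t ^ 2 >= 1 - 2 * d]. *)
pose d := Num.min 2^-1 (e / (2 * c)).
have d0 : 0 < d by rewrite lt_min invr_gt0 ltr0n divr_gt0// mulr_gt0.
have d2 : d <= 2^-1 by rewrite ge_min lexx.
have de : 2 * d * c <= e.
  have c2 : 0 < 2 * c by rewrite mulr_gt0.
  have : d <= e / (2 * c) by rewrite ge_min lexx orbT.
  by rewrite (ler_pdivlMr _ _ c2); apply: le_trans; rewrite [2 * d]mulrC -mulrA.
pose t := 1 - d; have t0 : 0 < t by rewrite /t; lra.
have t1 : t < 1 by rewrite /t; lra.
have tx0 : 0 < t * xi by rewrite mulr_gt0.
have ty0 : 0 < t * Y m.+1 xi by rewrite mulr_gt0.
have [B [Bu dB Br]] : exists B : 'M[R]_m,
  [/\ B \in unitmx, \det (B *m B^T) = 1 &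
    forall z : 'rV[int]_m, z != 0 -> t * xi <= sqnorm (map_mx intr z *m B)].
  apply: normalized_lattice => //; apply: lt_le_trans gle.
  by rewrite lte_fin (lt_le_trans _ xig)// gtr_pMl.
have Flt : F m.+1 (t * xi) (t * Y m.+1 xi) < level R m.+1.
  apply: (@le_lt_trans _ _ (F m.+1 xi (t * Y m.+1 xi))).
    by apply: F_le => //; rewrite ger_pMl// ltW.
  rewrite -FY; apply: F_lt_of_gt0; rewrite ?FY ?level_gt0//.
  by rewrite gtr_pMl.
apply: le_trans (hermite_constant_ge m0 Bu dB ty0 tx0 Br Flt).
rewrite -EFinB lee_fin powRM ?(ltW t0) ?(ltW Y0)//.
have -> : t * xi * (t `^ (2 / m.+1%:R) * Y m.+1 xi `^ (2 / m.+1%:R))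
    = t * t `^ (2 / m.+1%:R) * c by rewrite /c; ring.
(* The exponent is at most 1 since the dimension is at least 2, so the total loss is at most a
   factor [t ^ 2]. *)
have tp : t <= t `^ (2 / m.+1%:R).
  apply: ger1_powR; first by rewrite t0 ltW.
  by rewrite ler_pdivrMr// mul1r ler_nat.
apply: (@le_trans _ _ (t * t * c)); last first.
  by rewrite ler_wpM2r ?(ltW c0)// ler_wpM2l// ltW.
have -> : t * t * c = c - 2 * d * c + d * d * c by rewrite /t; ring.
apply: (@le_trans _ _ (c - 2 * d * c)); first by rewrite lerB.
by rewrite lerDl mulr_ge0 ?(ltW c0)// mulr_ge0// ltW.
Qed.
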